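(* Let $\Omega$ be a compact metric space and $\varphi:\Omega\to\Omega$ a continuous map such that $(\Omega,\varphi)$ is tame. Then: (i) for every ergodic operator net $\{V_\alpha\}\subset\mathcal{L}(X^* )$ there exist indices $\alpha(1),\alpha(2),\dots$ such that the sequence $\{V_{\alpha(n)}\}$ is ergodic and converges in the $\mathrm{W^*O}$-topology; (ii) every ergodic operator sequence $\{V_n\}\subset\mathcal{L}(X^* )$ contains a subsequence which is ergodic and converges in the $\mathrm{W^*O}$-topology. In particular, the sequence of Cesàro means $\frac{1}{n+1}(I+V+\dots+V^n)$ contains a $\mathrm{W^*O}$-convergent subsequence.
   Context: $X=C(\Omega)$ with sup norm, $X^*$ the space of Radon measures, pairing $(x,\mu)$. $Ux=x\circ\varphi$ (Koopman operator), $V=U^*\in\mathcal{L}(X^* )$. The $\mathrm{W^*O}$-topology on $\mathcal{L}(X^* )$: $T_\alpha\to T$ iff $(x,T_\alpha\mu)\to(x,T\mu)$ for all $x\in X,\mu\in X^*$. A net $\{V_\alpha\}\subseteq\operatorname{co}\{V^n:n\in\mathbb{N}_0\}$ is ergodic if $(x,(\operatorname{Id}-V)V_\alpha\mu)\to0$ for all $x\in X,\mu\in X^*$. The system $(\Omega,\varphi)$ is called tame if for every $x\in X$ and every strictly increasing sequence $\{n(k)\}\subseteq\mathbb{N}_0$ one has $\inf_a\|\sum_{k}a_k\, x\circ\varphi^{n(k)}\|_X=0$, where the infimum is over finitely supported scalar sequences $a$ with $\sum_k|a_k|=1$. *)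

(* Defs.v *)
From HB Require Import structures.
From mathcomp Require Import all_boot all_order all_algebra.
From mathcomp Require Import all_classical all_reals all_analysis.
Set Implicit Arguments. Unset Strict Implicit. Unset Printing Implicit Defensive.
Import Order.TTheory GRing.Theory Num.Theory.
Import numFieldNormedType.Exports.
Local Open Scope classical_set_scope.
Local Open Scope ring_scope.

Section Defs.
Variables (R : realType) (Omega : pseudoMetricType R).

(* X = C(Omega): elements are continuous x : Omega -> R; sup norm. *)
Definition supnorm (x : Omega -> R) : R := sup [set `|x w| | w in [set: Omega]].

(* X^star: bounded linear functionals on C(Omega) (values off C(Omega) irrelevant). *)
Definition dual_elt (m : (Omega -> R) -> R) : Prop :=
  (forall (a : R) (x y : Omega -> R), continuous x -> continuous y ->
     m (fun w => a * x w + y w) = a * m x + m y) /\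
  (exists M : R, forall x : Omega -> R, continuous x -> `|m x| <= M * supnorm x).

Definition dual_norm (m : (Omega -> R) -> R) : R :=
  sup [set `|m x| | x in [set x : Omega -> R | continuous x /\ supnorm x <= 1]].

Definition bounded_op (T : ((Omega -> R) -> R) -> ((Omega -> R) -> R)) : Prop :=
  (forall m, dual_elt m -> dual_elt (T m)) /\
  (forall (a : R) m n, dual_elt m -> dual_elt n -> forall x, continuous x ->
     T (fun y => a * m y + n y) x = a * T m x + T n x) /\
  (exists C : R, forall m, dual_elt m -> dual_norm (T m) <= C * dual_norm m).

Variable phi : Omega -> Omega.

Definition Vop (m : (Omega -> R) -> R) : (Omega -> R) -> R := fun x => m (x \o phi).

(* finite convex weights s : s`_k is the coefficient of V^k *)
Definition convex_w (s : seq R) : Prop :=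
  (forall k, 0 <= s`_k) /\ \sum_(k < size s) s`_k = 1.

(* the element sum_k s_k V^k of co{V^n} *)
Definition Vc (s : seq R) (m : (Omega -> R) -> R) : (Omega -> R) -> R :=
  fun x => m (fun w => \sum_(k < size s) s`_k * x (iter k phi w)).

Definition IdmV_pair (W : ((Omega -> R) -> R) -> ((Omega -> R) -> R))
  (m : (Omega -> R) -> R) (x : Omega -> R) : R :=
  W m x - Vop (W m) x.

Definition tame : Prop :=
  forall x : Omega -> R, continuous x ->
  forall n : nat -> nat, (forall i j, (i < j)%N -> (n i < n j)%N) ->
  inf [set supnorm (fun w => \sum_(k < size a) a`_k * x (iter (n k) phi w))
      | a in [set a : seq R | \sum_(k < size a) `|a`_k| = 1]] = 0.

End Defs.

Definition directed (I : Type) (le : I -> I -> Prop) : Prop :=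
  (exists i : I, True) /\ (forall a, le a a) /\
  (forall a b c, le a b -> le b c -> le a c) /\
  (forall a b, exists c, le a c /\ le b c).

Definition net_cvg (R : realType) (I : Type) (le : I -> I -> Prop) (f : I -> R) (l : R) : Prop :=
  forall e : R, 0 < e -> exists a0, forall a, le a0 a -> `|f a - l| < e.

Definition ergodic_net (R : realType) (Omega : pseudoMetricType R) (phi : Omega -> Omega)
  (I : Type) (le : I -> I -> Prop) (c : I -> seq R) : Prop :=
  forall (x : Omega -> R) (m : (Omega -> R) -> R), continuous x -> dual_elt m ->
    net_cvg le (fun a => IdmV_pair phi (Vc phi (c a)) m x) 0.

Definition nat_le (i j : nat) : Prop := (i <= j)%N.

Definition wo_cvg_seq (R : realType) (Omega : pseudoMetricType R)
  (S : nat -> ((Omega -> R) -> R) -> ((Omega -> R) -> R)) : Prop :=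
  exists T, bounded_op T /\
  forall (x : Omega -> R) (m : (Omega -> R) -> R), continuous x -> dual_elt m ->
    (fun n => S n m x) @ \oo --> T m x.

Definition cesaro_w (R : realType) (n : nat) : seq R := nseq n.+1 (n.+1%:R)^-1.

(* Main.v *)
(* Let [A_c x] be the convex combination of the [x \o phi^k] with weights [c].
   Rosenthal's dichotomy is proved with an ultrafilter: call a set of points small
   if it is exhausted, along the ultrafilter, by alternately imposing [y_a <= r]
   and [y_a >= s].  If the whole space is small for all rational [r < s], a
   sequence following the winning strategies converges pointwise; otherwise both
   halves of a big set are big for a common index, and splitting repeatedly
   yields an independent sequence.  Tameness forbids independence for the
   orbit of [x] by the l^1 lower bound.  It also forbids it for convex
   combinations: averaging over the points witnessing independence gives an
   integral-like functional [p] with [p |A_c x - A_c' x|] bounded below, whereas the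
   orbit, hence its convex hull, is totally bounded for [p |.|], by the dichotomy
   and Arzela's elementary bounded convergence theorem.  Bounded convergence then
   turns pointwise into weak convergence, and a countable family with dense span
   reduces everything to countably many functions.  For nets, the same game
   with the single condition [|z_a| >= e] extracts a null sequence from a
   pointwise null net of continuous functions on a compact space. *)
Require Import Defs.
From HB Require Import structures.
From mathcomp Require Import all_boot all_order all_algebra.
From mathcomp Require Import all_classical all_reals all_analysis.
From mathcomp Require Import lra ring.
Import Order.TTheory GRing.Theory Num.Theory.
Import numFieldNormedType.Exports.
Local Open Scope classical_set_scope.
Local Open Scope ring_scope.
Set Implicit Arguments. Unset Strict Implicit. Unset Printing Implicit Defensive.

(** * Set-cutting games played along a filter *)

Section Games.
Variables (I T : Type).
Implicit Types (h : seq I) (G : set_system I) (K : set T).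

Fixpoint hist (f : nat -> I) n : seq I :=
  if n is n'.+1 then f n' :: hist f n' else [::].

(** Histories are stored newest pick first, so the opening pick sits at the far end. Dropping it
    leaves a play of the game that follows that pick. *)
Lemma hist_shift (f : nat -> I) n :
  hist f n.+1 = rcons (hist (f \o succn) n) (f 0%N).
Proof. by elim: n => // n IH; rewrite -[hist f n.+2]/(f n.+1 :: hist f n.+1) IH. Qed.

Lemma dependent_choice_hist (P : seq I -> Prop) (E : seq I -> I -> Prop) :
  P [::] -> (forall h, P h -> exists a, E h a /\ P (a :: h)) ->
  exists f : nat -> I, forall n, E (hist f n) (f n) /\ P (hist f n).
Proof.
move=> P0 PS; have [a0 _] := PS _ P0.
have /choice [F PF] : forall h, exists a, P h -> E h a /\ P (a :: h).
  move=> h; case: (pselect (P h)) => [/PS[a Pa]|nP]; first by exists a.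
  by exists a0.
pose H := fix H n := if n is n'.+1 then F (H n') :: H n' else [::].
have PH n : P (H n) by elim: n => //= n /PF[].
exists (F \o H) => n.
have -> : hist (F \o H) n = H n by elim: n => //= n ->.
by split=> //; exact: (PF _ (PH n)).1.
Qed.

(** An inductive relation, since [I] carries no decidable equality. *)
Inductive sublist : seq I -> seq I -> Prop :=
| sublist_nil : sublist [::] [::]
| sublist_skip a s h : sublist s h -> sublist s (a :: h)
| sublist_take a s h : sublist s h -> sublist (a :: s) (a :: h).

(** A history has finitely many sublists. Those keeping the head [b] are handled by the shifted
    strategy [st (b :: s)]. *)
Lemma filter_sublists G (st : seq I -> set I) h : Filter G ->
  (forall s, G (st s)) -> G [set a | forall s, sublist s h -> st s a].
Proof.
move=> FG; elim: h st => [|b h IH] st GS.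
  by apply: filterS (GS [::]) => a Sa s; move: Sa => /[swap]; inversion 1.
apply: filterS (filterI (IH st GS) (IH (fun s => st (b :: s)) (fun s => GS _))).
by move=> a [Sa Sb] s; inversion 1; subst; [exact: Sa|exact: Sb].
Qed.

Lemma sublist_hist (f : nat -> I) (k : nat -> nat) i n :
  {homo k : x y / (x < y)%N} -> (forall j, (j < i)%N -> (k j < n)%N) ->
  sublist (hist (f \o k) i) (hist f n).
Proof.
move=> kinc; elim: n i => [|n IH] [|i] kn //=.
- exact: sublist_nil.
- by have := kn 0%N isT.
- by apply: sublist_skip; apply: (IH 0%N).
- have := kn i (ltnSn i); rewrite ltnS leq_eqVlt => /orP[/eqP kin|kin].
    rewrite kin; apply: sublist_take; apply: IH => j ji.
    by rewrite -kin kinc.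
  apply: sublist_skip; apply: (IH i.+1) => j; rewrite ltnS leq_eqVlt => /orP[/eqP->//|ji].
  exact: ltn_trans (kinc _ _ ji) kin.
Qed.

(* [small G Z b K]: in the game where the points of [K] are cut down by
   [Z b a0], [Z (~~ b) a1], [Z b a2], ..., the player who answers each time with
   a member of [G] from which the opponent picks [ai] can force the empty set. *)
Inductive small G (Z : bool -> I -> set T) : bool -> set T -> Prop :=
| small_empty b K : (forall w, ~ K w) -> small G Z b K
| small_step b K (E : set I) : G E ->
    (forall a, E a -> small G Z (~~ b) (K `&` Z b a)) -> small G Z b K.

Lemma small_set0 G Z b : small G Z b set0.
Proof. by apply: small_empty => w []. Qed.

Lemma small_sub G Z b K K' : K' `<=` K -> small G Z b K -> small G Z b K'.
Proof.
move=> K'K sK; elim: sK K' K'K => {}b {}K.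
  by move=> K0 K' K'K; apply: small_empty => w /K'K /K0.
move=> E GE _ IH K' K'K; apply: (small_step GE) => a Ea.
by apply: (IH a Ea) => w [Kw Zw]; split=> //; exact: K'K.
Qed.

(** Both games are played at once, answering with the intersection of the two answers. *)
Lemma small_setU G Z b K K' : Filter G ->
  small G Z b K -> small G Z b K' -> small G Z b (K `|` K').
Proof.
move=> FG sK; elim: sK K' => {}b {}K.
  move=> K0 K'; apply: small_sub => w [/K0//|//].
move=> E GE sE IH K' sK'; inversion sK'; subst.
  by apply: small_sub (small_step GE sE) => w [//|/H].
apply: (small_step (filterI GE H)) => a [Ea E0a]; rewrite setIUl.
by apply: (IH a Ea); exact: H0.
Qed.

(** The derivation of smallness is a well-founded tree, unrolled here into a strategy that reads the
    history. A play follows one branch, which is finite, and [n] is its length. *)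
Lemma strategy_of_small G Z b K : Filter G -> small G Z b K ->
  exists st : seq I -> set I, (forall h, G (st h)) /\
    forall f : nat -> I, (forall n, st (hist f n) (f n)) ->
    exists n, forall w, K w -> ~ (forall i, (i < n)%N -> Z (odd i (+) b) (f i) w).
Proof.
move=> FG; elim=> {}b {}K.
  move=> K0; exists (fun _ => setT); split=> [h|f _]; first exact: filterT.
  by exists 0%N => w /K0.
move=> E GE _ IH.
have /choice[st HS] : forall a, exists st : seq I -> set I, (forall h, G (st h)) /\
    (E a -> forall f : nat -> I, (forall n, st (hist f n) (f n)) ->
     exists n, forall w, (K `&` Z b a) w ->
       ~ (forall i, (i < n)%N -> Z (odd i (+) ~~ b) (f i) w)).
  move=> a; case: (pselect (E a)) => [/IH[st [S1 S2]]|nEa]; first by exists st.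
  by exists (fun _ => setT); split=> // h; exact: filterT.
(* The opening pick [a] selects the branch, whose strategy then sees only the later picks. *)
exists (fun h => if rev h is a :: t then st a (rev t) else E); split.
  by move=> h; case: (rev h) => // a t; exact: (HS a).1.
move=> f Sf; have E0 : E (f 0%N) by have := Sf 0%N.
have [n fn] : exists n, forall w, (K `&` Z b (f 0%N)) w ->
    ~ (forall i, (i < n)%N -> Z (odd i (+) ~~ b) ((f \o succn) i) w).
  apply: (HS (f 0%N)).2 => // n.
  by have := Sf n.+1; rewrite hist_shift rev_rcons revK.
exists n.+1 => w Kw Zw; apply: (fn w); first by split=> //; exact: (Zw 0%N).
move=> i ltin; have -> : odd i (+) ~~ b = odd i.+1 (+) b by rewrite /= addbN addNb.
exact: Zw.
Qed.

(* At each step only finitely many games and sublists of the history matter, so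
   one pick obeys all the corresponding strategies. *)
Lemma small_games_sequence G (Z : nat -> bool -> I -> set T)
    (E : seq I -> set I) : ProperFilter G -> (forall h, G (E h)) ->
  (forall j, small G (Z j) true setT) ->
  exists f : nat -> I, (forall n, E (hist f n) (f n)) /\
    forall j w (k : nat -> nat), {homo k : x y / (x < y)%N} ->
    ~ (forall i, Z j (odd i (+) true) (f (k i)) w).
Proof.
move=> PG GE sZ.
have [st HS] := choice (fun j => strategy_of_small _ (sZ j)).
pose good h a := E h a /\ forall j, (j <= size h)%N ->
  forall s, sublist s h -> st j s a.
have [||f goodf] := @dependent_choice_hist (fun _ => True) good.
- by [].
- move=> h _.
  have GS : G [set a | forall j : 'I_(size h).+1, forall s, sublist s h -> st j s a].
    by apply: filter_forall => j; apply: filter_sublists => s; exact: (HS j).1.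
  have [a [Ea Sa]] := filter_ex (filterI (GE h) GS).
  exists a; split=> //; split=> // j jh s sh.
  by apply: (Sa (Ordinal (jh : (j < (size h).+1)%N))).
have szh n : size (hist f n) = n by elim: n => //= n ->.
exists f; split=> [n|j w k kinc Zw]; first exact: (goodf n).1.1.
have kge i : (i <= k i)%N by elim: i => // i /leq_ltn_trans; apply; exact: kinc.
(* Skipping [j.*2] entries makes every index at least [j], so that game [j] is already enforced, and
   keeps the parity of the rounds. *)
pose k' i := k (i + j.*2)%N.
have [|n fn] := (HS j).2 (f \o k').
  move=> n; apply: (goodf (k' n)).1.2.
    by rewrite szh (leq_trans _ (kge _))// -addnn addnA leq_addl.
  apply: sublist_hist => [x y xy|i i_n]; apply: kinc; rewrite ltn_add2r//.
apply: (fn w) => // i _; rewrite /= /k'.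
by have := Zw (i + j.*2)%N; rewrite oddD odd_double addbF.
Qed.

End Games.

(** * Increasing sequences of indices *)

Lemma increasing_choice (Q : nat -> nat -> Prop) :
  (forall i N, exists2 n, (N <= n)%N & Q i n) ->
  exists2 k : nat -> nat, {homo k : x y / (x < y)%N} & forall i, Q i (k i).
Proof.
move=> HQ; have /choice[F HF] : forall p : nat * nat, exists n, (p.2 <= n)%N /\ Q p.1 n.
  by move=> [i N]; have [n Nn Qn] := HQ i N; exists n.
pose k := fix k i := if i is i'.+1 then F (i, (k i').+1) else F (0, 0)%N.
exists k; first by apply: homo_ltn => [|i]; [exact: ltn_trans|exact: (HF (_, _)).1].
by case=> [|i]; exact: (HF (_, _)).2.
Qed.

(** Used as the constraint [E] on picks, this forces the extracted indices to increase. *)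
Lemma near_lt_all (h : seq nat) : \forall a \near \oo, all (ltn^~ a) h.
Proof.
elim: h => [|b h [N _ NP]]; first by exists 0%N.
exists (maxn N b.+1) => // n /=; rewrite geq_max => /andP[Nn bn].
by apply/andP; split=> //; exact: NP.
Qed.

Lemma hist_increasing (f : nat -> nat) : (forall n, all (ltn^~ (f n)) (hist f n)) ->
  {homo f : i j / (i < j)%N}.
Proof.
move=> fP; apply: homo_ltn => [|i]; first exact: ltn_trans.
by have /andP[] := fP i.+1.
Qed.

(** * Independent sequences and big sets *)

Section Independence.
Variables (R : realType) (I T : Type).
Implicit Types (G : set_system I) (y : I -> T -> R) (K : set T).

(** Rosenthal's Boolean independence of level sets, with only finite initial patterns to be
    realised. *)
Definition independent (u : nat -> T -> R) (r s : R) :=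
  forall N (sg : nat -> bool), exists w, forall i, (i < N)%N ->
    if sg i then s <= u i w else u i w <= r.

Lemma independentN u r s :
  independent (fun n w => - u n w) r s -> independent u (- s) (- r).
Proof.
move=> ind N sg; have [w Hw] := ind N (fun i => ~~ sg i).
by exists w => i /Hw; case: (sg i) => /=; [rewrite lerNl|rewrite lerNr].
Qed.

(** [B h] lists the cells into which the history [h] cuts the space. Being finitely many, they are
    all split into big halves by a common pick, and nonemptiness of big cells realises the
    patterns. *)
Lemma independent_of_big G y (r s : R) (big : set T -> Prop)
    (E : seq I -> set I) : ProperFilter G -> (forall h, G (E h)) ->
  big setT -> (forall K, big K -> K !=set0) ->
  (forall K, big K -> G [set a | big (K `&` [set w | y a w <= r]) /\
                                 big (K `&` [set w | s <= y a w])]) ->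
  exists f : nat -> I, (forall n, E (hist f n) (f n)) /\
    independent (fun n => y (f n)) r s.
Proof.
move=> PG GE bT b0 bS.
pose B := fix B h : seq (set T) := if h is a :: h' then
  [seq K `&` [set w | y a w <= r] | K <- B h'] ++
  [seq K `&` [set w | s <= y a w] | K <- B h'] else [:: setT].
have [||f Ff] := @dependent_choice_hist _ (fun h => forall K, K \in B h -> big K) E.
- by move=> K; rewrite inE => /eqP ->.
- move=> h bB.
  have GB : G [set a | forall K, K \in B h ->
      big (K `&` [set w | y a w <= r]) /\ big (K `&` [set w | s <= y a w])].
    elim: (B h) bB => [|K L IH] bL; first by apply: filterS filterT => a _ K.
    apply: filterS (filterI (bS K (bL K (mem_head _ _))) (IH _)).
      by move=> a [aK aL] K'; rewrite inE => /orP[/eqP->//|/aL].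
    by move=> K' K'L; apply: bL; rewrite inE K'L orbT.
  have [a [Ea Ba]] := filter_ex (filterI (GE h) GB).
  exists a; split=> // K /=; rewrite mem_cat.
  by case/orP => /mapP[K' /Ba[Kl Kh] ->].
exists f; split=> [n|N sg]; first exact: (Ff n).1.
suff [K KB Kw] : exists2 K, K \in B (hist f N) & forall w, K w -> forall i,
    (i < N)%N -> if sg i then s <= y (f i) w else y (f i) w <= r.
  have [w /Kw] := b0 _ ((Ff N).2 K KB); by exists w.
elim: N => [|N [K KB Kw]] /=; first by exists setT; rewrite ?inE.
exists (K `&` if sg N then [set w | s <= y (f N) w] else [set w | y (f N) w <= r]).
  by rewrite mem_cat; case: (sg N); apply/orP; [right|left]; apply/mapP; exists K.
move=> w [/Kw iN wN] i; rewrite ltnS leq_eqVlt => /orP[/eqP->|/iN//].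
by case: (sg N) wN.
Qed.

(* A big set keeps both its halves big: a play of the game starting with a low
   (resp. high) cut that survives one more round survives without it. *)
Lemma big_halves G y (r s : R) K : UltraFilter G ->
  let Z b a := if b then [set w | y a w <= r] else [set w | s <= y a w] in
  ~ small G Z true K ->
  G [set a | ~ small G Z true (K `&` [set w | y a w <= r]) /\
             ~ small G Z true (K `&` [set w | s <= y a w])].
Proof.
move=> UG Z bK.
have PG : ProperFilter G by exact: ultra_proper.
have step b K' : ~ small G Z b K' -> G [set a | ~ small G Z (~~ b) (K' `&` Z b a)].
  move=> bK'; have [H|//] := in_ultra_setVsetC [set a | small G Z (~~ b) (K' `&` Z b a)] UG.
  by case: bK'; exact: small_step H _.
have G1 := step _ _ bK.
have [a0 /step Ga0] := filter_ex G1.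
apply: filterS (filterI G1 Ga0) => a [a1 a2]; split.
  have [c cP] := filter_ex (step _ _ a1); move=> sm; apply: cP.
  by apply: small_sub sm => w [].
by move=> sm; apply: a2; apply: small_sub sm => w [[? ?] ?].
Qed.

End Independence.

(** * Extraction of convergent sequences and of null sequences *)

Section Subsequences.
Variable R : realType.

Lemma ultra_bounded_cvg (I : Type) (G : set_system I) (u : I -> R) (C : R) :
  UltraFilter G -> (forall a, `|u a| <= C) -> exists l : R, u a @[a --> G] --> l.
Proof.
move=> UG uC.
have PG : ProperFilter G by exact: ultra_proper.
have UF : UltraFilter (u @ G).
  split=> [|F PF GF]; first exact: fmap_proper_filter.
   apply/seteqP; split=> [A FA|]; last exact: GF.
  have [//|GnA] := in_ultra_setVsetC (u @^-1` A) UG.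
  have FnA : F (~` A) by exact: GF.
  by have [x []] := filter_ex (filterI FA FnA).
have uG : (u @ G) `[- C, C]%classic.
  by apply: (@filterS _ G _ setT) => [a _|]; [rewrite /= in_itv /= -ler_norml|exact: filterT].
have := @segment_compact R (- C) C; rewrite compact_ultra => /(_ _ UF uG)[l [_ ul]].
by exists l.
Qed.

(** The limit [l] along an ultrafilter finer than [\oo] is a cluster value. If infinitely many terms
    stay at distance [e] from it on one side, two rationals on that side are crossed infinitely
    often. *)
Lemma cvg_of_no_oscillation (u : nat -> R) (C : R) : (forall n, `|u n| <= C) ->
  (forall p q : rat, p < q ->
    ~ ((forall N, exists2 n, (N <= n)%N & u n <= ratr p) /\
       (forall N, exists2 n, (N <= n)%N & ratr q <= u n))) ->
  cvg (u @ \oo).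
Proof.
move=> uC nosc.
have [G [UG ooG]] := ultraFilterLemma eventually_filter.
have PG : ProperFilter G by exact: ultra_proper.
have [l ul] := ultra_bounded_cvg UG uC.
have near_l (e : R) N : 0 < e -> exists2 n, (N <= n)%N & `|l - u n| < e.
  move=> e0; have /cvgrPdist_lt/(_ e e0) H := ul.
  have [n [lu Nn]] := filter_ex (filterI H (ooG _ (nbhs_infty_ge N))).
  by exists n.
apply/cvg_ex; exists l; apply/cvgrPdist_lt => e e0.
apply: contrapT => nl.
have freq : forall N, exists2 n, (N <= n)%N & e <= `|l - u n|.
  move=> N; apply: contrapT => nN; apply: nl; exists N => // n /= Nn.
  by rewrite ltNge; apply/negP => en; apply: nN; exists n.
have [up|nup] := pselect (forall N, exists2 n, (N <= n)%N & l + e <= u n).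
- have [q lq qe] : exists2 q : rat, l + e / 2 < ratr q & ratr q < l + e.
    have [|q] := @rat_in_itvoo R (l + e / 2) (l + e); first by lra.
    by rewrite in_itv /= => /andP[]; exists q.
  have [p lp pq] : exists2 p : rat, l < ratr p & ratr p < l + e / 2.
    have [|p] := @rat_in_itvoo R l (l + e / 2); first by lra.
    by rewrite in_itv /= => /andP[]; exists p.
  have pqr : p < q by rewrite -(ltr_rat R); lra.
  apply: (nosc p q pqr); split=> N.
    have [|n Nn ln] := near_l (ratr p - l) N; first by lra.
    by exists n => //; move: ln; rewrite ltr_norml => /andP[? ?]; lra.
  have [n Nn un] := up N; exists n => //; lra.
(* Otherwise the late excursions all lie below [l], and [p < q] are chosen on that side. *)
- have [N0 N0P] : exists N0, forall n, (N0 <= n)%N -> u n < l + e.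
    apply: contrapT => H; apply: nup => N; apply: contrapT => H'; apply: H.
    by exists N => n Nn; rewrite ltNge; apply/negP => ?; apply: H'; exists n.
  have [p lp pe] : exists2 p : rat, l - e < ratr p & ratr p < l - e / 2.
    have [|q] := @rat_in_itvoo R (l - e) (l - e / 2); first by lra.
    by rewrite in_itv /= => /andP[]; exists q.
  have [q lq pq] : exists2 q : rat, l - e / 2 < ratr q & ratr q < l.
    have [|q] := @rat_in_itvoo R (l - e / 2) l; first by lra.
    by rewrite in_itv /= => /andP[]; exists q.
  have pqr : p < q by rewrite -(ltr_rat R); lra.
  apply: (nosc p q pqr); split=> N.
    have [n Nn en] := freq (maxn N N0); exists n.
      by rewrite (leq_trans _ Nn)// leq_maxl.
    have := N0P n (leq_trans (leq_maxr _ _) Nn).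
    by move: en; rewrite ler_normr => /orP[|]; lra.
  have [|n Nn ln] := near_l (l - ratr q) N; first by lra.
  by exists n => //; move: ln; rewrite ltr_norml => /andP[? ?]; lra.
Qed.

Section Rosenthal.
Variables (I T : Type).

(** There is one game for each [j] and each pair of rationals [p < q]. A game that is not small
    would, by [big_halves], yield an independent sequence obeying [E]. A point where [y j]
    oscillates across [p] and [q] would survive a play of a game that no point survives. *)
Lemma rosenthal_sequence (G : set_system I) (y : nat -> I -> T -> R)
    (E : seq I -> set I) (C : nat -> R) :
  UltraFilter G -> (forall h, G (E h)) -> (forall j a w, `|y j a w| <= C j) ->
  (forall j r s f, r < s -> (forall n, E (hist f n) (f n)) ->
    ~ independent (fun n => y j (f n)) r s) ->
  exists f : nat -> I, (forall n, E (hist f n) (f n)) /\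
    forall j w, cvg (y j (f n) w @[n --> \oo]).
Proof.
move=> UG GE yC nind.
have PG : ProperFilter G by exact: ultra_proper.
pose Z0 j (p q : rat) (b : bool) a :=
  if b then [set w | y j a w <= ratr p] else [set w | ratr q <= y j a w].
(* Codes of no triple with [p < q] get empty sets, a game won at once. *)
pose Z (c : nat) b a : set T :=
  if unpickle c is Some (j, (p, q)) then
    if (p : rat) < q then Z0 j p q b a else set0
  else set0.
have small0 c : (forall b a, Z c b a = set0) -> small G (Z c) true setT.
  move=> Z0E; apply: (@small_step _ _ _ _ _ _ setT) => [|a _]; first exact: filterT.
  by rewrite Z0E setI0; exact: small_set0.
have [|f [Ef Hf]] := small_games_sequence PG GE (Z := Z).
  move=> c; case Ec : (unpickle c : option (nat * (rat * rat))) => [[j [p q]]|]; last first.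
    by apply: small0 => b a; rewrite /Z Ec.
  have [pq|npq] := boolP (p < q); last first.
    by apply: small0 => b a; rewrite /Z Ec (negbTE npq).
  have -> : Z c = Z0 j p q by apply/funext => b; apply/funext => a; rewrite /Z Ec pq.
  apply: contrapT => bT.
  have [|K bK|f [Ef]] := independent_of_big PG GE (y := y j) (r := ratr p) (s := ratr q)
    (big := fun K => ~ small G (Z0 j p q) true K) bT.
  - by move=> K bK; apply/set0P/eqP => K0; apply: bK; rewrite K0; exact: small_set0.
  - exact: big_halves.
  by apply: nind; rewrite ?ltr_rat.
exists f; split=> // j w.
apply: (@cvg_of_no_oscillation _ (C j)) => // p q pq [low high].
have [|k kinc kP] := @increasing_choice (fun i n =>
    if odd i then ratr q <= y j (f n) w else y j (f n) w <= ratr p).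
  by move=> i N; case: (odd i).
apply: (Hf (pickle (j, (p, q))) w k kinc) => i.
by rewrite /Z pickleK pq /Z0; have := kP i; case: (odd i).
Qed.

End Rosenthal.

(** The sets whose complement meets [K] in a small set form a proper filter, with a cluster point
    [w0]. Every neighbourhood of [w0] meets [K] in a big set, and since [z a w0] tends to 0, the set
    where [z a] is below [e / 2] is such a neighbourhood for most [a]. *)
Lemma compact_big_halves (I : Type) (T : topologicalType) (G : set_system I)
    (z : I -> T -> R) (e : R) (K : set T) :
  UltraFilter G -> compact [set: T] -> 0 < e ->
  (forall a, continuous (z a)) -> (forall w, z a w @[a --> G] --> (0 : R)) ->
  let Z (b : bool) a := [set w | e <= z a w] in
  (forall b, ~ small G Z b K) ->
  G [set a | (forall b, ~ small G Z b (K `&` [set w | z a w <= e / 2])) /\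
             (forall b, ~ small G Z b (K `&` [set w | e <= z a w]))].
Proof.
move=> UG cT e0 cz z0 Z bK.
have PG : ProperFilter G by exact: ultra_proper.
have bool_irr b b' K' : small G Z b K' -> small G Z b' K'.
  move=> sK; elim: sK b' => {}b {}K'; first by move=> ? ?; exact: small_empty.
  by move=> E GE _ IH b'; apply: (small_step GE) => a /IH.
pose F := [set A : set T | small G Z true (K `&` ~` A)].
have PF : ProperFilter F.
  split.
    by move=> F0; apply: (bK true); move: F0; rewrite /F /= setC0 setIT.
  split.
  - by rewrite /F /= setCT setI0; exact: small_set0.
  - move=> A B FA FB; rewrite /F /= setCI setIUr; exact: small_setU.
  - by move=> A B AB; apply: small_sub => w [Kw nB]; split=> // /AB.
have [w0 [_ clw0]] := cT F PF filterT.
have wK B : nbhs w0 B -> forall b, ~ small G Z b (K `&` B).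
  move=> wB b /(bool_irr _ true) sB.
  have /(_ (~` B) B)[|//|w []//] := clw0.
  by rewrite /F /= setCK.
have G1 : G [set a | forall b, ~ small G Z b (K `&` [set w | e <= z a w])].
  have [H|] := in_ultra_setVsetC [set a | small G Z true (K `&` [set w | e <= z a w])] UG.
    by case: (bK true); apply: (small_step H) => a; exact: bool_irr.
  by apply: filterS => a na b /(bool_irr _ true).
have e20 : 0 < e / 2 by rewrite divr_gt0.
have /cvgrPdist_lt/(_ _ e20) := z0 w0.
move=> G2; apply: filterS (filterI G1 G2) => a [a1 a2]; split=> // b.
apply: wK.
have : nbhs (z a w0) [set t | t < e / 2].
  apply: open_nbhs_nbhs; split; first exact: open_lt.
  by move: a2; rewrite /= sub0r normrN => /(le_lt_trans (ler_norm _)).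
move=> /(cz a w0); apply: (@filterS _ (nbhs w0)) => w; exact: ltW.
Qed.

(** There is one game for each [j], threshold [1 / (m + 1)] and sign. If one were not small,
    [compact_big_halves] would make [z j] or its opposite independent between half the threshold and
    the threshold. *)
Lemma compact_null_sequence (I : Type) (T : topologicalType) (G : set_system I)
    (z : nat -> I -> T -> R) :
  UltraFilter G -> compact [set: T] ->
  (forall j a, continuous (z j a)) ->
  (forall j w, z j a w @[a --> G] --> (0 : R)) ->
  (forall j r s f, r < s -> ~ independent (fun n => z j (f n)) r s) ->
  exists f : nat -> I, forall j w, z j (f n) w @[n --> \oo] --> (0 : R).
Proof.
move=> UG cT cz z0 nind.
have PG : ProperFilter G by exact: ultra_proper.
pose Z0 j m (sg : bool) a := [set w | m.+1%:R^-1 <= (if sg then z j a w else - z j a w)].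
pose Z (c : nat) (b : bool) a : set T :=
  if unpickle c is Some (j, (m, sg)) then Z0 j m sg a else set0.
have [||f [_ Hf]] := small_games_sequence PG (E := fun _ => setT) (Z := Z).
  by move=> h; exact: filterT.
  move=> c; case Ec : (unpickle c : option (nat * (nat * bool))) => [[j [m sg]]|]; last first.
    apply: (@small_step _ _ _ _ _ _ setT) => [|a _]; first exact: filterT.
    by rewrite /Z Ec setI0; exact: small_set0.
  have -> : Z c = fun=> Z0 j m sg by apply/funext => b; apply/funext => a; rewrite /Z Ec.
  apply: contrapT => bT.
  have m0 : 0 < m.+1%:R^-1 :> R by rewrite invr_gt0.
  pose zs a w := if sg then z j a w else - z j a w.
  have zsc a : continuous (zs a).
    rewrite /zs; case: (sg); first exact: cz.
    by move=> w; apply: cvgN; exact: cz.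
  have zs0 w : zs a w @[a --> G] --> (0 : R).
    rewrite /zs; case: (sg); first exact: z0.
    by rewrite -oppr0; apply: cvgN; exact: z0.
  pose big K := forall b, ~ small G (fun _ : bool => Z0 j m sg) b K.
  have [|||K bK|f [_]] := @independent_of_big _ _ _ G zs (m.+1%:R^-1 / 2) m.+1%:R^-1 big
      (fun _ => setT) PG.
  - by move=> _; exact: filterT.
  - move=> b sb; apply: bT; case: b sb => // sb.
    by apply: (small_step filterT) => a _; apply: small_sub sb => w [].
  - by move=> K bK; apply/set0P/eqP => K0; apply: (bK true); rewrite K0; exact: small_set0.
  - exact: compact_big_halves.
  have half (t : R) : 0 < t -> t / 2 < t by lra.
  rewrite /zs; case: (sg) => [|/independentN]; apply: nind; last rewrite ltrN2.
    exact: half.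
  exact: half.
exists f => j w; apply/cvgrPdist_lt => e e0.
have [m me] := ltr_add_invr e0; rewrite add0r in me.
apply: contrapT => nl.
have freq : forall N, exists2 n, (N <= n)%N & e <= `|z j (f n) w|.
  move=> N; apply: contrapT => nN; apply: nl; exists N => // n /= Nn.
  by rewrite sub0r normrN ltNge; apply/negP => en; apply: nN; exists n.
(* One sign recurs among the large values, giving a play that [w] would survive. *)
have [sg freqs] : exists sg : bool, forall N, exists2 n, (N <= n)%N &
    m.+1%:R^-1 <= if sg then z j (f n) w else - z j (f n) w.
  apply: contrapT => H.
  have nT (sg : bool) : exists N, forall n, (N <= n)%N ->
      (if sg then z j (f n) w else - z j (f n) w) < m.+1%:R^-1.
    apply: contrapT => H1; apply: H; exists sg => N; apply: contrapT => H2; apply: H1.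
    by exists N => n Nn; rewrite ltNge; apply/negP => ?; apply: H2; exists n.
  have [N1 N1P] := nT true; have [N2 N2P] := nT false.
  have [n Nn] := freq (maxn N1 N2); apply/negP; rewrite -ltNge ltr_norml.
  have := N1P n (leq_trans (leq_maxl _ _) Nn).
  have := N2P n (leq_trans (leq_maxr _ _) Nn).
  by move=> /= zN zP; rewrite ltrNl !(lt_trans _ me).
have [|k kinc kP] := @increasing_choice (fun _ n =>
    m.+1%:R^-1 <= if sg then z j (f n) w else - z j (f n) w).
  by move=> _ N; exact: freqs.
apply: (Hf (pickle (j, (m, sg))) w k kinc) => i.
by rewrite /Z pickleK; exact: kP.
Qed.

End Subsequences.

(** * Dini's theorem and Arzela's bounded convergence *)

Section BoundedConvergence.
Variables (R : realType) (T : topologicalType).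
Hypothesis cT : compact [set: T].
Implicit Types (f g : T -> R) (p : (T -> R) -> R).

(** Otherwise points [v n] with [e <= h n (v n)] cluster at some [w]. Some [h n] is below [e] near
    [w], yet by monotonicity it is at least [e] at all later points [v m]. *)
Lemma dini (h : nat -> T -> R) (e : R) : (forall n, continuous (h n)) ->
  (forall n w, h n.+1 w <= h n w) -> (forall w, exists n, h n w < e) ->
  exists n, forall w, h n w < e.
Proof.
move=> ch hdec hlt; apply: contrapT => H.
have /choice[v vP] : forall n, exists w, e <= h n w.
  move=> n; apply: contrapT => Hn; apply: H; exists n => w.
  by rewrite ltNge; apply/negP => ?; apply: Hn; exists w.
have hmono n m w : (n <= m)%N -> h m w <= h n w.
  by move/subnK <-; elim: (m - n)%N => // k IH; rewrite addSn (le_trans (hdec _ _)).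
have [w [_ clw]] := cT (fmap_proper_filter v eventually_filter) filterT.
have [n nw] := hlt w.
have [||u [/= eu ue]] := clw [set u | e <= h n u] [set u | h n u < e].
- by exists n => // m /= nm; rewrite (le_trans (vP m))// hmono.
- have : nbhs (h n w) [set t | t < e].
    by apply: open_nbhs_nbhs; split=> //; exact: open_lt.
  by move/(ch n w).
- by move: ue; rewrite ltNge eu.
Qed.

(* The properties of integration against a finite positive measure that the
   bounded convergence theorem needs; only nonnegative functions matter. *)
Definition positive_additive p :=
  [/\ forall f g, continuous f -> continuous g ->
        (forall w, 0 <= f w) -> (forall w, 0 <= g w) ->
        p (fun w => f w + g w) = p f + p g,
      forall f, continuous f -> (forall w, 0 <= f w) -> 0 <= p f &
      exists M : R, forall f c, continuous f -> (forall w, 0 <= f w <= c) -> 0 <= c ->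
        p f <= M * c].

Section PositiveAdditive.
Variable p : (T -> R) -> R.
Hypothesis pp : positive_additive p.

Lemma positive_additive_le f g : continuous f -> continuous g ->
  (forall w, 0 <= f w) -> (forall w, f w <= g w) -> p f <= p g.
Proof.
case: pp => pD p0 _ cf cg f0 fg.
have -> : g = fun w => f w + (g w - f w) by apply/funext => w; ring.
have cgf : continuous (fun w => g w - f w).
  by move=> w; apply: cvgB; [exact: cg|exact: cf].
have gf0 w : 0 <= g w - f w by rewrite subr_ge0.
by rewrite pD// lerDl p0.
Qed.

Lemma positive_additive_max_min f g : continuous f -> continuous g ->
  (forall w, 0 <= f w) -> (forall w, 0 <= g w) ->
  p (fun w => Num.max (f w) (g w)) + p (fun w => Num.min (f w) (g w)) = p f + p g.
Proof.
case: pp => pD _ _ cf cg f0 g0.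
have cmax : continuous (fun w => Num.max (f w) (g w)).
  by move=> w; apply: continuous_max; [exact: cf|exact: cg].
have cmin : continuous (fun w => Num.min (f w) (g w)).
  by move=> w; apply: continuous_min; [exact: cf|exact: cg].
rewrite -!pD//; first by congr p; apply/funext => w; exact: addr_max_min.
- by move=> w; rewrite le_max f0.
- by move=> w; rewrite le_min f0 g0.
Qed.

(* Arzela's argument: with [h n] the maximum of [g n, ..., g (n + q n)], [q n]
   chosen so that longer maxima do not increase [p] much, the decreasing minima
   of the [h i] keep [p] large although they tend to [0], uniformly by Dini. *)
Lemma arzela_small (g : nat -> T -> R) (C e : R) : (forall n, continuous (g n)) ->
  (forall n w, 0 <= g n w <= C) -> (forall w, g n w @[n --> \oo] --> (0 : R)) ->
  0 < e -> exists n, p (g n) < e.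
Proof.
move=> cg gC g0 e0; apply: contrapT => H.
have pg n : e <= p (g n) by rewrite leNgt; apply/negP => ?; apply: H; exists n.
pose mx := fix mx n q := if q is q'.+1
  then fun w => Num.max (mx n q' w) (g (n + q)%N w) else g n.
have cmx n q : continuous (mx n q).
  elim: q => [|q IH]; first exact: cg.
  by move=> w; apply: continuous_max; [exact: IH|exact: cg].
have mx_ge n q w k : (n <= k <= n + q)%N -> g k w <= mx n q w.
  elim: q => [|q IH] /andP[nk].
    by rewrite addn0 => kn; rewrite (_ : k = n)//; apply/eqP; rewrite eqn_leq kn nk.
  rewrite addnS leq_eqVlt => /orP[/eqP->|]; rewrite /= le_max.
    by rewrite addnS lexx orbT.
  by rewrite ltnS => kq; rewrite IH ?nk.
have mx_le n q w t : (forall k, (n <= k <= n + q)%N -> g k w <= t) -> mx n q w <= t.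
  elim: q => [|q IH] Hq /=; first by apply: Hq; rewrite addn0 leqnn.
  rewrite ge_max IH /=; first by apply: Hq; rewrite leq_addr leqnn.
  by move=> k /andP[nk kq]; apply: Hq; rewrite nk (leq_trans kq)// leq_add2l.
have mx0 n q w : 0 <= mx n q w.
  by apply: le_trans (mx_ge n q w n _); [have /andP[] := gC n w|rewrite leqnn leq_addr].
have mxC n q w : mx n q w <= C by apply: mx_le => k _; have /andP[] := gC k w.
have [pD p0 [M pM]] := pp.
have pmxM n q : p (mx n q) <= M * `|C|.
  apply: pM => // w; rewrite mx0 (le_trans (mxC _ _ _))//; exact: ler_norm.
(* Admissible gains, with total below [e / 2]. *)
pose d n : R := e / 2 / 2 ^+ n.+1.
have d0 n : 0 < d n by rewrite !divr_gt0// exprn_gt0.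
have /choice[q qP] : forall n, exists q, forall q', p (mx n q') <= p (mx n q) + d n.
  move=> n; have sE : has_sup [set p (mx n q) | q in [set: nat]].
    split; first by exists (p (mx n 0)), 0%N.
    by exists (M * `|C|) => _ [q _ <-].
  have [_ [q _ <-] qd] := sup_adherent (d0 n) sE; exists q => q'.
  have : p (mx n q') <= sup [set p (mx n q) | q in [set: nat]].
    by apply: sup_upper_bound => //; exists q'.
  by move: qd; lra.
pose h n := mx n (q n).
pose m := fix m n := if n is n'.+1
  then fun w => Num.min (m n' w) (h n w) else h 0%N.
have cm n : continuous (m n).
  elim: n => [|n IH]; first exact: cmx.
  by move=> w; apply: continuous_min; [exact: IH|exact: cmx].
have m0 n w : 0 <= m n w by elim: n => [|n IH]; rewrite /= ?le_min ?IH mx0.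
have mh n w : m n w <= h n w by case: n => //= n; rewrite ge_min lexx orbT.
have pm n : p (h n) - p (m n) <= \sum_(i < n) d i.
  elim: n => [|n IH]; first by rewrite subrr big_ord0.
  rewrite big_ord_recr /=.
  have := positive_additive_max_min (cm n) (cmx n.+1 (q n.+1)) (m0 n) (mx0 _ _).
  (* Since [m n <= h n], this maximum lies below a longer maximum starting at [n], which gains at
     most [d n]. *)
  have : p (fun w => Num.max (m n w) (h n.+1 w)) <= p (h n) + d n.
    apply: le_trans (qP n (q n + (q n.+1).+1)%N).
    apply: positive_additive_le.
    - by move=> w; apply: continuous_max; [exact: cm|exact: cmx].
    - exact: cmx.
    - by move=> w; rewrite le_max m0.
    - move=> w; rewrite ge_max (le_trans (mh _ _)) /=; last first.
        apply: mx_le => k /andP[nk kq]; apply: mx_ge; rewrite nk (leq_trans kq)//.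
        by rewrite leq_add2l leq_addr.
      apply: mx_le => k /andP[nk kq]; apply: mx_ge; rewrite (ltnW nk) (leq_trans kq)//.
      by rewrite addSnnS leq_add2l leq_addl.
  by rewrite -/(h n.+1); move: IH; lra.
have sumd n : \sum_(i < n) d i = e / 2 - e / 2 / 2 ^+ n.
  elim: n => [|n IH]; first by rewrite big_ord0 expr0 divr1 subrr.
  rewrite big_ord_recr /= IH /d exprS; field.
  by rewrite expf_neq0.
have pm_ge n : e / 2 <= p (m n).
  have : p (h n) - p (m n) <= e / 2.
    by rewrite (le_trans (pm n))// sumd gerBl !divr_ge0 ?exprn_ge0// ltW.
  have : e <= p (h n).
    apply: (le_trans (pg n)); apply: positive_additive_le; [exact: cg|exact: cmx| |].
      by move=> w; have /andP[] := gC n w.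
    by move=> w; apply: mx_ge; rewrite leqnn leq_addr.
  by lra.
(* A uniform bound by [c] makes [p] at most [e / 4], against [pm_ge]. *)
pose c := e / 4 / (`|M| + 1).
have M1 : 0 < `|M| + 1 by rewrite ltr_wpDl.
have c0 : 0 < c by rewrite divr_gt0// divr_gt0.
have [n w|w|n mc] := dini (h := m) (e := c) cm.
- by rewrite /= ge_min lexx.
- have /cvgrPdist_lt/(_ _ c0)[N _ NP] := g0 w.
  exists N; apply: le_lt_trans (mh N w) _.
  have [k /andP[Nk _] ->] : exists2 k, (N <= k <= N + q N)%N & h N w = g k w.
    rewrite /h; elim: (q N) => [|i [k /andP[Nk ki] IH]] /=.
      by exists N => //; rewrite leqnn leq_addr.
    have [mg|gm] := leP (mx N i w) (g (N + i.+1)%N w).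
      by exists (N + i.+1)%N => //; rewrite leqnn leq_addr.
    by exists k => //; rewrite Nk addnS ltnW.
  by have := NP k Nk; rewrite sub0r normrN; apply: le_lt_trans; exact: ler_norm.
have : p (m n) <= M * c.
  by apply: pM => //; [move=> w; rewrite m0 ltW|exact: ltW].
have : M * c <= e / 4.
  rewrite (@le_trans _ _ ((`|M| + 1) * c))//.
    by rewrite ler_pM2r// (le_trans (ler_norm _))// lerDl.
  by rewrite /c mulrCA mulfV ?mulr1// gt_eqF.
by have := pm_ge n; move: e0; lra.
Qed.

(** Failure gives pairs of ever later indices whose absolute differences keep [p] at least [e].
    These differences are bounded and tend to 0 pointwise, contradicting [arzela_small]. *)
Lemma arzela_cauchy (f : nat -> T -> R) (C e : R) : (forall n, continuous (f n)) ->
  (forall n w, `|f n w| <= C) -> (forall w, cvg (f n w @[n --> \oo])) -> 0 < e ->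
  exists N, forall n m, (N <= n)%N -> (N <= m)%N -> p (fun w => `|f n w - f m w|) < e.
Proof.
move=> cf fC fcvg e0; apply: contrapT => H.
have /choice[k kP] : forall N, exists k : nat * nat, [/\ (N <= k.1)%N, (N <= k.2)%N &
    e <= p (fun w => `|f k.1 w - f k.2 w|)].
  move=> N; apply: contrapT => HN; apply: H; exists N => n m Nn Nm.
  by rewrite ltNge; apply/negP => enm; apply: HN; exists (n, m).
have [||||N] := @arzela_small (fun N w => `|f (k N).1 w - f (k N).2 w|) (C + C) e.
- by move=> n w; apply: cvg_norm; apply: cvgB; exact: cf.
- by move=> n w; rewrite normr_ge0 (le_trans (ler_normB _ _))// lerD.
- move=> w; have /cvg_ex[l /cvgrPdist_lt fl] := fcvg w.
  apply/cvgrPdist_lt => t t0.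
  have t20 : 0 < t / 2 by rewrite divr_gt0.
  have [N _ NP] := fl _ t20; exists N => // n /= Nn.
  have [k1 k2 _] := kP n.
  have := NP _ (leq_trans Nn k1); have := NP _ (leq_trans Nn k2).
  rewrite sub0r normrN normr_id /= => d2 d1.
  rewrite (_ : f _ w - f _ w = (l - f (k n).2 w) - (l - f (k n).1 w)); last by ring.
  by rewrite (le_lt_trans (ler_normB _ _))// (splitr t) ltrD.
- by [].
by have [_ _] := kP N; rewrite leNgt => /negP.
Qed.

End PositiveAdditive.
End BoundedConvergence.

(** * Functionals on continuous functions and their variation *)

Section Dual.
Variables (R : realType) (Omega : pseudoMetricType R).
Hypothesis cT : compact [set: Omega].
Implicit Types (x y f g : Omega -> R) (m : (Omega -> R) -> R).

Lemma supnorm_ub x w : continuous x -> `|x w| <= supnorm x.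
Proof.
move=> cx; apply: sup_upper_bound; last by exists w.
split; first by exists `|x w|, w.
have : compact [set `|x w| | w in [set: Omega]].
  apply: continuous_compact cT; apply: continuous_subspaceT => v.
  by apply: cvg_norm; exact: cx.
move/compact_bounded => [M [_ MP]]; exists (M + 1) => _ [v _ <-].
rewrite -[leLHS]normr_id; apply: MP; first by rewrite ltrDl.
by exists v.
Qed.

Lemma supnorm_le x (C : R) : 0 <= C -> (forall w, `|x w| <= C) -> supnorm x <= C.
Proof.
move=> C0 xC; rewrite /supnorm.
have [->|/set0P E0] := eqVneq [set `|x w| | w in [set: Omega]] set0; first by rewrite sup0.
by apply: ge_sup => // _ [w _ <-].
Qed.

Lemma supnorm_ge0 x : continuous x -> 0 <= supnorm x.
Proof.
move=> cx; rewrite /supnorm.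
have [->|/set0P[_ [w _ _]]] := eqVneq [set `|x w| | w in [set: Omega]] set0.
  by rewrite sup0.
exact: le_trans (supnorm_ub w cx).
Qed.

Section DualElt.
Variable m : (Omega -> R) -> R.
Hypothesis dm : dual_elt m.

Lemma dual_bound : exists2 M : R, 0 <= M & forall x C, continuous x -> 0 <= C ->
  (forall w, `|x w| <= C) -> `|m x| <= M * C.
Proof.
have [_ [M MP]] := dm; exists `|M| => // x C cx C0 xC.
rewrite (le_trans (MP _ cx))// (@le_trans _ _ (`|M| * supnorm x))//.
  by rewrite ler_wpM2r ?supnorm_ge0// ler_norm.
by rewrite ler_wpM2l// supnorm_le.
Qed.

Lemma dual_linear a x y : continuous x -> continuous y ->
  m (fun w => a * x w + y w) = a * m x + m y.
Proof. exact: dm.1. Qed.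

Lemma dualD x y : continuous x -> continuous y -> m (fun w => x w + y w) = m x + m y.
Proof.
move=> cx cy; rewrite -[m x]mul1r -dual_linear//.
by congr m; apply/funext => w; rewrite mul1r.
Qed.

Lemma dualB x y : continuous x -> continuous y -> m (fun w => x w - y w) = m x - m y.
Proof.
move=> cx cy; rewrite addrC -mulN1r -dual_linear//.
by congr m; apply/funext => w; rewrite mulN1r addrC.
Qed.

Lemma dual0 : m (fun=> 0) = 0.
Proof.
have c0 : continuous (fun _ : Omega => 0 : R) by move=> w; exact: cvg_cst.
rewrite -[RHS](subrr (m (fun=> 0))) -dualB//.
by congr m; apply/funext => w; rewrite subrr.
Qed.

Lemma dualN x : continuous x -> m (fun w => - x w) = - m x.
Proof.
move=> cx; rewrite -[RHS]add0r -dual0 -dualB//; last by move=> w; exact: cvg_cst.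
by congr m; apply/funext => w; rewrite sub0r.
Qed.

(** For nonnegative [f] this is the modulus of [m] as in a Riesz space: integration against the
    total variation measure. *)
Definition abs_dual f := sup [set m g | g in [set g | continuous g /\ forall w, `|g w| <= f w]].

Lemma abs_dual_ub f g : continuous f -> continuous g -> (forall w, `|g w| <= f w) ->
  m g <= abs_dual f.
Proof.
move=> cf cg gf; apply: sup_upper_bound; last by exists g.
split; first by exists (m g), g.
have [M M0 MP] := dual_bound; exists (M * supnorm f) => _ [h [ch hf] <-].
rewrite (le_trans (ler_norm _))//; apply: MP => //; first exact: supnorm_ge0.
move=> w; rewrite (le_trans (hf w))// (le_trans _ (supnorm_ub w cf))//; exact: ler_norm.
Qed.

Lemma abs_dual_le f (c : R) : (forall w, 0 <= f w) ->
  (forall g, continuous g -> (forall w, `|g w| <= f w) -> m g <= c) -> abs_dual f <= c.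
Proof.
move=> f0 fc; apply: ge_sup => [|_ [g [cg gf] <-]]; last exact: fc.
exists (m (fun=> 0)), (fun=> 0) => //; split=> [w|w]; first exact: cvg_cst.
by rewrite normr0.
Qed.

Lemma abs_dual_positive_additive : positive_additive abs_dual.
Proof.
split.
- move=> f g cf cg f0 g0.
  have cfg : continuous (fun w => f w + g w).
    by move=> w; apply: cvgD; [exact: cf|exact: cg].
  apply/eqP; rewrite eq_le; apply/andP; split.
    apply: abs_dual_le => [w|h ch hfg]; first by rewrite addr_ge0.
    (* Riesz decomposition: [h] is clamped between [- f] and [f], and the remainder is bounded by
       [g]. *)
    pose h1 w := Num.max (- f w) (Num.min (h w) (f w)).
    have ch1 : continuous h1.
      move=> w; apply: (@continuous_max _ _ (fun w => - f w) (fun w => Num.min (h w) (f w))).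
        by apply: cvgN; exact: cf.
      by apply: continuous_min; [exact: ch|exact: cf].
    have chh1 : continuous (fun w => h w - h1 w).
      by move=> w; apply: cvgB; [exact: ch|exact: ch1].
    have -> : h = fun w => h1 w + (h w - h1 w) by apply/funext => w; ring.
    rewrite dualD// lerD// abs_dual_ub// => w; have := hfg w; have := f0 w; have := g0 w.
      move=> _ ? _; rewrite ler_norml /h1 ge_max ge_min le_max lexx lexx orbT andbT /=.
      by rewrite ge0_cp.
    move=> ? ?; rewrite !ler_norml => /andP[? ?]; rewrite /h1.
    by case: (leP (h w) (f w)) => ?; [case: (leP (- f w) (h w)) => ?|
      case: (leP (- f w) (f w)) => ?]; apply/andP; split; lra.
  rewrite -lerBrDr; apply: abs_dual_le => // f1 cf1 ff1.
  rewrite lerBrDr addrC -lerBrDr; apply: abs_dual_le => // g1 cg1 gg1.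
  rewrite lerBrDr addrC -dualD// abs_dual_ub//.
    by move=> w; apply: cvgD; [exact: cf1|exact: cg1].
  by move=> w; rewrite (le_trans (ler_normD _ _))// lerD.
- move=> f cf f0; rewrite -dual0 abs_dual_ub// => w; last by rewrite normr0.
  exact: cvg_cst.
- have [M M0 MP] := dual_bound; exists M => f c cf fc c0.
  apply: abs_dual_le => [w|g cg gf]; first by have /andP[] := fc w.
  rewrite (le_trans (ler_norm _))// MP// => w; rewrite (le_trans (gf w))//.
  by have /andP[] := fc w.
Qed.

Lemma dual_le_abs f : continuous f -> `|m f| <= abs_dual (fun w => `|f w|).
Proof.
move=> cf; have cnf : continuous (fun w => `|f w|).
  by move=> w; apply: cvg_norm; exact: cf.
have cNf : continuous (fun w => - f w) by move=> w; apply: cvgN; exact: cf.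
rewrite ler_norml lerNl -dualN// !abs_dual_ub// => w; by rewrite normrN.
Qed.

(** The pointwise limit may be discontinuous, so the values are shown to be Cauchy: differences are
    dominated by [abs_dual], to which [arzela_cauchy] applies. *)
Lemma dual_cvg (f : nat -> Omega -> R) (C : R) : (forall n, continuous (f n)) ->
  (forall n w, `|f n w| <= C) -> (forall w, cvg (f n w @[n --> \oo])) ->
  cvg (m (f n) @[n --> \oo]).
Proof.
move=> cf fC fcvg; apply: cauchy_cvg; apply: cauchy_exP => e e0.
have [N NP] := arzela_cauchy cT abs_dual_positive_additive cf fC fcvg e0.
exists (m (f N)); exists N => // n /= Nn; rewrite /ball /=.
rewrite -dualB//; apply: le_lt_trans (NP N n _ Nn) => //.
by apply: dual_le_abs => w; apply: cvgB; exact: cf.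
Qed.

Lemma dual_cvg0 (f : nat -> Omega -> R) (C : R) : (forall n, continuous (f n)) ->
  (forall n w, `|f n w| <= C) -> (forall w, f n w @[n --> \oo] --> (0 : R)) ->
  m (f n) @[n --> \oo] --> (0 : R).
Proof.
move=> cf fC f0; apply/cvgrPdist_lt => e e0; apply: contrapT => H.
have /choice[k kP] : forall N, exists n, (N <= n)%N /\ e <= `|m (f n)|.
  move=> N; apply: contrapT => HN; apply: H; exists N => // n /= Nn.
  by rewrite sub0r normrN ltNge; apply/negP => ?; apply: HN; exists n.
have [n w|n w|w|//|n] := arzela_small cT abs_dual_positive_additive
    (g := fun n w => `|f (k n) w|) (C := C) (e := e).
- by apply: cvg_norm; exact: cf.
- by rewrite normr_ge0 fC.
- apply/cvgrPdist_lt => t t0; have /cvgrPdist_lt/(_ _ t0)[N _ NP] := f0 w.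
  exists N => // n /= Nn; have := NP _ (leq_trans Nn (kP n).1).
  by rewrite !sub0r !normrN normr_id.
by rewrite ltNge => /negP; apply; apply: (le_trans (kP n).2); exact: dual_le_abs.
Qed.

End DualElt.
End Dual.

(** * A countable family with dense span *)

Section DenseSpan.
Variables (R : realType) (Omega : pseudoMetricType R).
Hypothesis hT : hausdorff_space Omega.
Hypothesis cT : compact [set: Omega].

(** Without a finite cover, the sets that cover the space together with finitely many [N w] form a
    proper filter. It contains the complement of every [N w], so it has no cluster point. *)
Lemma compact_finite_cover (N : Omega -> set Omega) : (forall w, nbhs w (N w)) ->
  exists s : seq Omega, forall z, exists2 w, w \in s & N w z.
Proof.
move=> nN; apply: contrapT => H.
pose F := [set A : set Omega | exists s : seq Omega,
  forall z, (exists2 w, w \in s & N w z) \/ A z].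
have PF : ProperFilter F.
  split; first by move=> [s sP]; apply: H; exists s => z; case: (sP z).
  split; first by exists [::]; right.
  - move=> A B [s sA] [t tB]; exists (s ++ t) => z.
    have [[w ws wz]|Az] := sA z; first by left; exists w; rewrite ?mem_cat ?ws.
    have [[w wt wz]|Bz] := tB z; first by left; exists w; rewrite ?mem_cat ?wt ?orbT.
    by right.
  - move=> A B AB [s sA]; exists s => z; have [?|/AB ?] := sA z; by [left|right].
have [w [_ clw]] := cT PF filterT.
have FnN : F (~` N w).
  exists [:: w] => z; have [?|?] := pselect (N w z); last by right.
  by left; exists w; rewrite ?inE.
by have [z []] := clw _ _ FnN (nN w).
Qed.

Lemma compact_uniform_continuity (x : Omega -> R) (e : R) : continuous x -> 0 < e ->
  exists2 d : R, 0 < d & forall z v, ball z d v -> `|x z - x v| <= e.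
Proof.
move=> cx e0; have e20 : 0 < e / 2 by rewrite divr_gt0.
have /choice[d dP] : forall w, exists d : R, 0 < d /\ forall v, ball w (d + d) v -> `|x w - x v| < e / 2.
  move=> w; have /cvgrPdist_lt/(_ _ e20) := cx w.
  move/nbhs_ballP => [d /= d0 dP]; exists (d / 2); split; first by rewrite divr_gt0.
  by move=> v wv; apply: dP; rewrite /= -splitr in wv.
have [s sP] := compact_finite_cover (fun w => nbhsx_ballx w _ (dP w).1).
pose m := \big[Num.min/1]_(w <- s) d w.
have m0 : 0 < m.
  by rewrite /m; apply: (big_ind (fun t => 0 < t)) => [//|a b a0 b0|w _]; [rewrite lt_min a0|exact: (dP w).1].
exists m => // z v zv; have [w ws wz] := sP z.
have mw : m <= d w by rewrite /m ge_bigmin_seq.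
have H1 : `|x w - x z| < e / 2.
  by apply: (dP w).2; apply: le_ball wz; rewrite lerDl ltW// (dP w).1.
have H2 : `|x w - x v| < e / 2.
  by apply: (dP w).2; apply: (ball_triangle wz); exact: le_ball zv.
rewrite (_ : x z - x v = (x w - x v) - (x w - x z)); last by ring.
by rewrite (le_trans (ler_normB _ _))// (splitr e) ltW// ltrD.
Qed.

(** A Urysohn function for the closures of the ball and of the complement of the tripled ball. The
    factor 3 absorbs one approximation within [r] for each closure. *)
Lemma ball_separation (w : Omega) (r : R) : 0 < r -> exists u : Omega -> R,
  [/\ continuous u, forall z, 0 <= u z, forall z, ball w r z -> u z = 1 &
      forall z, ~ ball w (r *+ 3) z -> u z = 0].
Proof.
move=> r0; pose A := closure (~` ball w (r *+ 3)); pose B := closure (ball w r).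
have sep : uniform_separator A B.
  apply: (iffLR (@normal_separatorP R Omega)).
  - exact: compact_normal.
  - exact: closed_closure.
  - exact: closed_closure.
  apply/seteqP; split=> // z [/(_ _ (nbhsx_ballx z r r0))[a [/= wa za]]].
  move=> /(_ _ (nbhsx_ballx z r r0))[b [/= wb zb]]; apply: wa.
  rewrite (_ : r *+ 3 = r + r + r); last by ring.
  by apply: ball_triangle za; apply: ball_triangle wb _; exact: ball_sym.
exists (Urysohn A B); split; first exact: Urysohn_continuous.
- move=> z; have : range (@Urysohn _ R A B) (Urysohn A B z) by exists z.
  by move/Urysohn_range; rewrite /= in_itv /= => /andP[].
- move=> z wz; apply: (Urysohn_sub1 sep); exists z => //; exact: subset_closure.
- move=> z wz; apply: (Urysohn_sub0 sep); exists z => //; exact: subset_closure.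
Qed.

(** Bumps from [ball_separation], at finitely many centres whose balls cover the space, are divided
    by their positive sum. *)
Lemma partition_of_unity (d : R) : 0 < d -> exists (s : seq Omega) (g : Omega -> Omega -> R),
  [/\ forall w, continuous (g w), forall w z, 0 <= g w z,
      forall z, \sum_(w <- s) g w z = 1 & forall w z, ~ ball w d z -> g w z = 0].
Proof.
move=> d0; have d30 : 0 < d / 3 by rewrite divr_gt0.
have /choice[u uP] := fun w => ball_separation w d30.
have [s sP] := compact_finite_cover (fun w => nbhsx_ballx w _ d30).
pose t z := \sum_(w <- s) u w z.
have t0 z : 0 < t z.
  have [w ws wz] := sP z; have [_ u0 u1 _] := uP w.
  rewrite /t (big_rem w)//= u1// ltr_pwDl// sumr_ge0// => v _.
  by have [_ + _ _] := uP v.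
have ct : continuous t.
  rewrite /t; elim: (s) => [|w s' IH].
    rewrite (_ : (fun z => _) = fun=> 0); first by move=> z; exact: cvg_cst.
    by apply/funext => v; rewrite big_nil.
  rewrite (_ : (fun z => _) = fun v => u w v + \sum_(w <- s') u w v); last first.
    by apply/funext => v; rewrite big_cons.
  by move=> z; apply: cvgD; [have [cu _ _ _] := uP w; exact: cu|exact: IH].
exists s, (fun w z => u w z / t z); split.
- move=> w z; apply: cvgM; first by have [cu _ _ _] := uP w; exact: cu.
  by apply: cvgV; [rewrite lt0r_neq0|exact: ct].
- by move=> w z; rewrite divr_ge0 ?(ltW (t0 z))//; have [_ + _ _] := uP w.
- by move=> z; rewrite -mulr_suml; exact: (mulfV (lt0r_neq0 (t0 z))).
- move=> w z wz; have [_ _ _ ->] := uP w; first by rewrite mul0r.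
  by rewrite (_ : d / 3 *+ 3 = d)//; field.
Qed.

(** Density of the span, phrased as an induction principle for properties closed under linear
    combinations and uniform limits. *)
Definition spans_densely (e : nat -> Omega -> R) :=
  forall P : (Omega -> R) -> Prop, (forall j, P (e j)) -> P (fun=> 0) ->
  (forall a x y, continuous x -> continuous y -> P x -> P y -> P (fun w => a * x w + y w)) ->
  (forall x, continuous x -> (forall eps, 0 < eps -> exists y,
     [/\ continuous y, P y & forall w, `|x w - y w| <= eps]) -> P x) ->
  forall x, continuous x -> P x.

(** The family collects partitions of unity at all scales [1 / (n + 1)]. By uniform continuity, [x]
    is close to the sum of the [x w * g n w] once the scale is fine. *)
Lemma countable_dense_span : exists2 e : nat -> Omega -> R,
  (forall j, continuous (e j)) & spans_densely e.
Proof.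
have r0 n : 0 < n.+1%:R^-1 :> R by rewrite invr_gt0.
have /choice[s /choice[g gP]] := fun n => partition_of_unity (r0 n).
have c0 : continuous (fun _ : Omega => 0 : R) by move=> w; exact: cvg_cst.
pose e c : Omega -> R := if unpickle c is Some (n, i)
  then nth (fun=> 0) [seq g n w | w <- s n] i else fun=> 0.
have eE n w : w \in s n -> exists c, e c = g n w.
  move=> ws; exists (pickle (n, index w (s n))); rewrite /e pickleK.
  by rewrite (nth_map w) ?index_mem// nth_index.
exists e.
  move=> c; rewrite /e; case: unpickle => [[n i]|]; last exact: c0.
  have [si|] := leqP (size (s n)) i; first by rewrite nth_default ?size_map//; exact: c0.
  case Es : (s n) => [//|w t] it; rewrite (nth_map w) ?Es//.
  by have [cu _ _ _] := gP n; exact: cu.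
move=> P Pe P0 PD Pcl x cx; apply: Pcl => // eps eps0.
have [d d0 dP] := compact_uniform_continuity cx eps0.
have [n] := ltr_add_invr d0; rewrite add0r => nd.
have [cg g0 g1 gsupp] := gP n.
have [cy Py] : continuous (fun v => \sum_(w <- s n) x w * g n w v) /\
    P (fun v => \sum_(w <- s n) x w * g n w v).
  have : {subset s n <= s n} by [].
  elim: {1 3 4}(s n) => [|w t IH] ts.
    rewrite (_ : (fun v => _) = fun=> 0); first by split.
    by apply/funext => v; rewrite big_nil.
  rewrite (_ : (fun v => _) = fun v => x w * g n w v + \sum_(w <- t) x w * g n w v); last first.
    by apply/funext => v; rewrite big_cons.
  have [|ct Pt] := IH; first by move=> v vt; apply: ts; rewrite inE vt orbT.
  split; last by apply: PD => //; have [c <-] := eE n w (ts _ (mem_head _ _)).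
  by move=> v; apply: cvgD; [apply: cvgMr; exact: cg|exact: ct].
exists (fun v => \sum_(w <- s n) x w * g n w v); split=> // v.
rewrite -[x v]mulr1 -(g1 v) mulr_sumr -sumrB (le_trans (ler_norm_sum _ _ _))//.
rewrite -[leRHS]mulr1 -(g1 v) mulr_sumr ler_sum// => w _.
rewrite -mulrBl normrM (ger0_norm (g0 _ _)).
have [wv|nwv] := pselect (ball w n.+1%:R^-1 v).
  rewrite ler_wpM2r// distrC dP//; apply: le_ball wv; exact: ltW.
by rewrite gsupp// !mulr0.
Qed.

End DenseSpan.

(** * Finite combinations and ultralimits of averages *)

Lemma continuous_sum_scale (R : realType) (T : topologicalType) (N : nat)
    (a : nat -> R) (f : nat -> T -> R) : (forall k, continuous (f k)) ->
  continuous (fun w => \sum_(k < N) a k * f k w).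
Proof.
move=> cf; elim: N => [|N IH].
  rewrite (_ : (fun w => _) = fun=> 0); first by move=> w; exact: cvg_cst.
  by apply/funext => w; rewrite big_ord0.
rewrite (_ : (fun w => _) = fun w => \sum_(k < N) a k * f k w + a N * f N w); last first.
  by apply/funext => w; rewrite big_ord_recr.
by move=> w; apply: cvgD; [exact: IH|apply: cvgMr; exact: cf].
Qed.

(* Averaging over all the sign patterns of a large finite piece of an independent
   sequence, and passing to the limit along an ultrafilter, gives a functional
   for which the terms of the sequence are uniformly separated. *)
Section UltralimitOfAverages.
Variables (R : realType) (T : topologicalType) (G : set_system nat).
Hypotheses (cT : compact [set: T]) (UG : UltraFilter G) (ooG : \oo `<=` G).
Variables (y : nat -> T -> R) (r s : R) (W : forall N, {ffun 'I_N -> bool} -> T).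
Hypothesis WP : forall N (sg : {ffun 'I_N -> bool}) (i : 'I_N),
  if sg i then s <= y i (W sg) else y i (W sg) <= r.

Let PG : ProperFilter G. Proof. exact: ultra_proper. Qed.

Definition average N (f : T -> R) := (\sum_(sg : {ffun 'I_N -> bool}) f (W sg)) / 2 ^+ N.

Definition ultra_average f : R := lim (average N f @[N --> G]).

Lemma average_cst N (c : R) : average N (fun=> c) = c.
Proof.
rewrite /average sumr_const card_ffun card_bool card_ord -[c *+ _]mulr_natr natrX mulfK// expf_neq0.
Qed.

Lemma average_le N f g : (forall w, f w <= g w) -> average N f <= average N g.
Proof.
move=> fg; rewrite /average ler_wpM2r ?invr_ge0 ?exprn_ge0//.
by apply: ler_sum => i _; exact: fg.
Qed.

Lemma ultra_average_cvg f (C : R) : (forall w, `|f w| <= C) ->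
  average N f @[N --> G] --> ultra_average f.
Proof.
move=> fC; have [|l fl] := @ultra_bounded_cvg _ _ G (fun N => average N f) C UG.
  move=> N; rewrite ler_norml -[leLHS](average_cst N) -[X in _ && (_ <= X)](average_cst N).
  by apply/andP; split; apply: average_le => w; have := fC w; rewrite ler_norml => /andP[].
by rewrite /ultra_average (cvg_lim (@Rhausdorff R) fl).
Qed.

Lemma ultra_averageD f g (C : R) : (forall w, `|f w| <= C) -> (forall w, `|g w| <= C) ->
  ultra_average (fun w => f w + g w) = ultra_average f + ultra_average g.
Proof.
move=> fC gC; apply: (cvg_lim (@Rhausdorff R)).
rewrite (_ : (fun N => _) = fun N => average N f + average N g); last first.
  by apply/funext => N; rewrite /average big_split mulrDl.
by apply: cvgD; exact: ultra_average_cvg.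
Qed.

Lemma ultra_averageZ a f (C : R) : (forall w, `|f w| <= C) ->
  ultra_average (fun w => a * f w) = a * ultra_average f.
Proof.
move=> fC; apply: (cvg_lim (@Rhausdorff R)).
rewrite (_ : (fun N => _) = fun N => a * average N f); last first.
  by apply/funext => N; rewrite /average -mulr_sumr mulrA.
by apply: cvgMr; exact: ultra_average_cvg.
Qed.

Lemma ultra_average_ge f (c C : R) : (forall w, `|f w| <= C) ->
  (\forall N \near \oo, c <= average N f) -> c <= ultra_average f.
Proof.
move=> fC /ooG cf; have fl := ultra_average_cvg fC.
rewrite leNgt; apply/negP => fc.
have e0 : 0 < c - ultra_average f by rewrite subr_gt0.
have /cvgrPdist_lt/(_ _ e0) Gf := fl.
have [N [/= cN]] := filter_ex (filterI cf Gf).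
by rewrite distrC => /(le_lt_trans (ler_norm _)); lra.
Qed.

Lemma ultra_average_le f (c C : R) : (forall w, `|f w| <= C) -> (forall w, f w <= c) ->
  ultra_average f <= c.
Proof.
move=> fC fc; rewrite -lerN2 -[leRHS]mulN1r -(ultra_averageZ _ fC).
apply: (@ultra_average_ge _ _ C) => [w|]; first by rewrite mulN1r normrN.
exists 0%N => // N _; rewrite -[leLHS](average_cst N).
by apply: average_le => w; rewrite mulN1r lerN2.
Qed.

Lemma compact_bounded_fun (f : T -> R) : continuous f -> exists C, forall w, `|f w| <= C.
Proof.
move=> cf; have : compact [set f w | w in [set: T]].
  by apply: continuous_compact cT; apply: continuous_subspaceT.
move/compact_bounded => [M [_ MP]]; exists (M + 1) => w.
by apply: MP; [rewrite ltrDl|exists w].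
Qed.

Lemma ultra_average_positive_additive : positive_additive ultra_average.
Proof.
split.
- move=> f g cf cg _ _.
  have [C fC] := compact_bounded_fun cf; have [D gD] := compact_bounded_fun cg.
  by apply: (@ultra_averageD _ _ (Num.max C D)) => w; rewrite le_max ?fC ?gD ?orbT.
- move=> f cf f0; have [C fC] := compact_bounded_fun cf.
  apply: (ultra_average_ge fC); exists 0%N => // N _.
  by rewrite -(average_cst N 0); exact: average_le.
- exists 1 => f c _ fc c0; rewrite mul1r; apply: (@ultra_average_le _ _ c) => w.
    by rewrite ger0_norm; have /andP[] := fc w.
  by have /andP[] := fc w.
Qed.

Let flip N (i : 'I_N) (sg : {ffun 'I_N -> bool}) : {ffun 'I_N -> bool} :=
  [ffun j => if j == i then ~~ sg j else sg j].

Let flipK N (i : 'I_N) : involutive (flip i).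
Proof. by move=> sg; apply/ffunP => j; rewrite !ffunE; case: eqP => // _; rewrite negbK. Qed.

(** Each pattern is paired with its flip at [i]. In one of the two, the entries at [i] and [j]
    differ, so that summand is at least [s - r]. *)
Lemma average_separated N (i j : 'I_N) : i != j ->
  (s - r) / 2 <= average N (fun w => `|y i w - y j w|).
Proof.
move=> ij; set F := fun w => `|y i w - y j w|.
have FF (sg : {ffun 'I_N -> bool}) : s - r <= F (W sg) + F (W (flip i sg)).
  have := WP sg i; have := WP sg j; have := WP (flip i sg) i; have := WP (flip i sg) j.
  rewrite !ffunE eqxx eq_sym (negbTE ij) /F.
  have n1 := normr_ge0 (y i (W sg) - y j (W sg)).
  have n2 := normr_ge0 (y i (W (flip i sg)) - y j (W (flip i sg))).
  have := ler_norm (y i (W sg) - y j (W sg)).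
  have := ler_norm (y i (W (flip i sg)) - y j (W (flip i sg))).
  have := ler_norm (- (y i (W sg) - y j (W sg))).
  have := ler_norm (- (y i (W (flip i sg)) - y j (W (flip i sg)))).
  by rewrite !normrN; case: (sg i); case: (sg j) => /=; lra.
have : average N (fun=> s - r) <= average N F + average N F.
  rewrite {3}/average (reindex_inj (inv_inj (flipK i))) /= /average -mulrDl -big_split /=.
  by rewrite ler_wpM2r ?invr_ge0 ?exprn_ge0// ler_sum.
by rewrite average_cst; lra.
Qed.

End UltralimitOfAverages.

(** * Convex combinations of an orbit in a tame system *)

Section ConvexHull.
Variables (R : realType) (Omega : pseudoMetricType R) (phi : Omega -> Omega).
Hypotheses (cT : compact [set: Omega]) (cphi : continuous phi).
Implicit Types (x : Omega -> R) (s : seq R).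

(** [Vc phi s m x] unfolds to [m] evaluated at this function. *)
Definition weighted_orbit s x w := \sum_(k < size s) s`_k * x (iter k phi w).

Lemma iter_continuous x k : continuous x -> continuous (fun w => x (iter k phi w)).
Proof.
move=> cx; elim: k => [|k IH]; first exact: cx.
rewrite (_ : (fun w => _) = (fun w => x (iter k phi w)) \o phi).
  by move=> w; apply: continuous_comp; [exact: cphi|exact: IH].
by apply/funext => w /=; rewrite -iterSr.
Qed.

Lemma weighted_orbit_continuous s x : continuous x -> continuous (weighted_orbit s x).
Proof.
move=> cx; exact: (@continuous_sum_scale _ _ (size s) (fun k => s`_k)
  (fun k w => x (iter k phi w)) (fun k => iter_continuous cx)).
Qed.

Lemma weighted_orbit_linear s a x y :
  weighted_orbit s (fun w => a * x w + y w) =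
  fun w => a * weighted_orbit s x w + weighted_orbit s y w.
Proof.
apply/funext => w; rewrite /weighted_orbit mulr_sumr -big_split /=.
by apply: eq_bigr => k _; rewrite mulrDr mulrCA.
Qed.

Lemma weighted_orbitB s x y :
  weighted_orbit s (fun w => x w - y w) =
  fun w => weighted_orbit s x w - weighted_orbit s y w.
Proof.
have := weighted_orbit_linear s (-1) y x.
rewrite (_ : (fun w => _) = fun w => x w - y w); last first.
  by apply/funext => w; rewrite mulN1r addrC.
by move=> ->; apply/funext => w; rewrite mulN1r addrC.
Qed.

Lemma weighted_orbit_bound s x (C : R) : convex_w s -> (forall w, `|x w| <= C) ->
  forall w, `|weighted_orbit s x w| <= C.
Proof.
move=> [s0 s1] xC w; rewrite (le_trans (ler_norm_sum _ _ _))//.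
rewrite -[leRHS]mul1r -s1 mulr_suml ler_sum// => k _.
by rewrite normrM (ger0_norm (s0 k)) ler_wpM2l.
Qed.

(** For coefficients [a] of l^1 norm 1, a point [u] following their signs and a point [v] following
    the opposite signs give values at least [s - r] apart. Hence every sup norm in the infimum is at
    least [(s - r) / 2]. *)
Lemma tame_not_independent x (n : nat -> nat) (r s : R) : tame phi -> continuous x ->
  {homo n : i j / (i < j)%N} -> r < s ->
  ~ independent (fun k w => x (iter (n k) phi w)) r s.
Proof.
move=> tm cx ninc rs ind.
have := tm x cx n ninc; set E := (X in inf X) => infE.
have : (s - r) / 2 <= inf E.
  apply: lb_le_inf.
    exists (supnorm (fun w => \sum_(k < size [:: 1 : R]) [:: 1]`_k * x (iter (n k) phi w))).
    by exists [:: 1] => //=; rewrite big_ord1 /= normr1.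
  move=> _ [a a1 <-]; set F := fun w => _.
  have cF : continuous F.
    by apply: (@continuous_sum_scale _ _ _ (fun k => a`_k) (fun k w => x (iter (n k) phi w))) => k;
       exact: iter_continuous.
  have [u uP] := ind (size a) (fun k => 0 <= a`_k).
  have [v vP] := ind (size a) (fun k => a`_k < 0).
  have : s - r <= F u - F v.
    rewrite /F -sumrB -[leLHS]mul1r -a1 mulr_suml ler_sum// => k _.
    rewrite -mulrBr; have := uP k (ltn_ord k); have := vP k (ltn_ord k).
    have [a0|a0] := leP 0 a`_k => xv xu.
      by rewrite ger0_norm// ler_wpM2l// lerB.
    rewrite ltr0_norm// mulNr -mulrN ler_wnM2l ?(ltW a0)// opprB.
    by rewrite lerB.
  have := supnorm_ub cT u cF; have := supnorm_ub cT v cF.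
  by rewrite !ler_norml => /andP[? ?] /andP[? ?]; lra.
by rewrite infE; move: rs; lra.
Qed.

Section Seminorm.
Variable p : (Omega -> R) -> R.
Hypothesis pp : positive_additive p.
Hypothesis pZ : forall (a : R) (f : Omega -> R), continuous f -> p (fun w => a * f w) = a * p f.
Let q (f : Omega -> R) := p (fun w => `|f w|).

Let cabs (f : Omega -> R) : continuous f -> continuous (fun w => `|f w|).
Proof. by move=> cf w; apply: cvg_norm; exact: cf. Qed.

Let q_triangle (f g : Omega -> R) : continuous f -> continuous g ->
  q (fun w => f w + g w) <= q f + q g.
Proof.
move=> cf cg; have [pD _ _] := pp; rewrite /q -pD//; try exact: cabs.
apply: positive_additive_le => //.
- by apply: cabs => w; apply: cvgD; [exact: cf|exact: cg].
- by move=> w; apply: cvgD; [exact: (cabs cf)|exact: (cabs cg)].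
- by move=> w; exact: ler_normD.
Qed.

Let q_sum N (a : nat -> R) (f : nat -> Omega -> R) : (forall k, continuous (f k)) ->
  q (fun w => \sum_(k < N) a k * f k w) <= \sum_(k < N) `|a k| * q (f k).
Proof.
move=> cf; elim: N => [|N IH].
  rewrite big_ord0 /q (_ : (fun w => _) = fun w => 0 * `|f 0%N w|).
    by rewrite pZ ?mul0r//; exact: cabs.
  by apply/funext => w; rewrite big_ord0 normr0 mul0r.
rewrite (_ : (fun w => _) = fun w => \sum_(k < N) a k * f k w + a N * f N w); last first.
  by apply/funext => w; rewrite big_ord_recr.
rewrite big_ord_recr /= (le_trans (q_triangle _ _))//.
- exact: continuous_sum_scale.
- by move=> w; apply: cvgMr; exact: cf.
- rewrite lerD// {1}/q (_ : (fun w => _) = fun w => `|a N| * `|f N w|).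
    by rewrite pZ//; exact: cabs.
  by apply/funext => w; rewrite normrM.
Qed.

(** Otherwise the orbit contains an infinite sequence that is [e]-separated for [q]. By tameness it
    has a pointwise convergent subsequence, which is [q]-Cauchy by [arzela_cauchy]. *)
Lemma orbit_totally_bounded x (e : R) : tame phi -> continuous x -> 0 < e ->
  exists N, forall k, exists2 i, (i <= N)%N &
    p (fun w => `|x (iter k phi w) - x (iter i phi w)|) <= e.
Proof.
move=> tm cx e0; apply: contrapT => H; pose f k w := x (iter k phi w).
have cf k : continuous (f k) by exact: iter_continuous.
have /choice[K KP] : forall N, exists k, forall i, (i <= N)%N ->
    e < q (fun w => f k w - f i w).
  move=> N; apply: contrapT => HN; apply: H; exists N => k; apply: contrapT => Hk.
  apply: HN; exists k => i iN; rewrite ltNge; apply/negP => ?; apply: Hk.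
  by exists i.
have q0 : q (fun=> 0) = 0.
  rewrite /q (_ : (fun w => _) = fun w => 0 * `|x w|).
    by rewrite pZ ?mul0r//; exact: cabs.
  by apply/funext => w; rewrite normr0 mul0r.
(* An index at most [N] would have to be separated from itself. *)
have KN N : (N < K N)%N.
  rewrite ltnNge; apply/negP => /KP.
  rewrite (_ : (fun w => _) = fun=> 0); last by apply/funext => w; rewrite subrr.
  by rewrite q0 ltNge (ltW e0).
pose k := fix k j := if j is j'.+1 then K (k j') else 0%N.
have kinc : {homo k : i j / (i < j)%N} by apply: homo_ltn => [|i]; [exact: ltn_trans|exact: KN].
have kmono : {homo k : i j / (i <= j)%N} by exact: ltnW_homo.
have ksep i j : (i < j)%N -> e < q (fun w => f (k j) w - f (k i) w).
  by case: j => // j; rewrite ltnS => ij; apply: KP; exact: kmono.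
have [G [UG ooG]] := ultraFilterLemma eventually_filter.
have PG : ProperFilter G by exact: ultra_proper.
have [C xC] := compact_bounded_fun cT cx.
have [h|j a w|j r s h rs /hist_increasing hinc|h [/hist_increasing hinc hcvg]] := @rosenthal_sequence R nat Omega G
    (fun _ a => f (k a)) (fun h => [set a | all (ltn^~ a) h]) (fun=> C) UG.
- by apply: ooG; exact: near_lt_all.
- exact: xC.
- exact: (tame_not_independent tm cx (fun i j ij => kinc _ _ (hinc _ _ ij)) rs).
have [N NP] := @arzela_cauchy _ _ cT _ pp (fun n => f (k (h n))) C e (fun n => cf _)
  (fun n w => xC _) (hcvg 0%N) e0.
have := NP N.+1 N (leqnSn N) (leqnn N).
by rewrite ltNge (ltW (ksep _ _ (hinc _ _ (ltnSn N)))).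
Qed.

(* Replacing each [x \o phi^k] by an [e]-close one among the first [N + 1] moves
   convex combinations of the orbit close to a simplex, where an ultralimit
   provides two close terms. *)
Lemma convex_hull_not_separated x (c : nat -> seq R) (d : R) : tame phi -> continuous x ->
  (forall n, convex_w (c n)) -> 0 < d -> exists i j, (i < j)%N /\
    p (fun w => `|weighted_orbit (c i) x w - weighted_orbit (c j) x w|) < d.
Proof.
move=> tm cx cvx d0; pose f k w := x (iter k phi w).
have cf k : continuous (f k) by exact: iter_continuous.
have [C xC] := compact_bounded_fun cT cx.
have [_ p0 [M pM]] := pp.
pose D := `|M| * `|C|.
have D0 : 0 <= D by rewrite mulr_ge0.
have qD k : q (f k) <= D.
  apply: (@le_trans _ _ (M * `|C|)); last by rewrite ler_wpM2r// ler_norm.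
  apply: pM => //; first exact: cabs.
  by move=> w; rewrite normr_ge0 (le_trans (xC _))// ler_norm.
(* Two replacements costing [e] each and the simplex distance [(e + e) * D] then add up to
   [d / 2]. *)
pose e := d / 4 / (1 + D).
have D1 : 0 < 1 + D by rewrite ltr_pwDl.
have e0 : 0 < e by rewrite !divr_gt0.
have eD : e + e + (e + e) * D < d.
  have -> : e + e + (e + e) * D = d / 2 by rewrite /e; field; rewrite lt0r_neq0.
  by move: d0; lra.
have [N /choice[i /all_and2[iN iq]]] : exists N, forall k, exists i, (i <= N)%N /\
    q (fun w => f k w - f i w) <= e.
  have [N NP] := orbit_totally_bounded tm cx e0.
  by exists N => k; have [i iN iq] := NP k; exists i.
(* The mass that [c n] puts on the orbit terms replaced by term [j]. *)
pose t n j := \sum_(k < size (c n) | i k == j) (c n)`_k.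
have [G [UG ooG]] := ultraFilterLemma eventually_filter.
have PG : ProperFilter G by exact: ultra_proper.
have /choice[l lP] : forall j, exists l : R, t n j @[n --> G] --> l.
  move=> j; apply: (@ultra_bounded_cvg _ _ _ _ 1) => n; have [c0 c1] := cvx n.
  rewrite ger0_norm; last by apply: sumr_ge0 => k _; exact: c0.
  rewrite -c1 /t big_mkcond ler_sum// => k _; by case: ifP => // _; exact: c0.
have N0 : 0 < e / N.+1%:R by rewrite divr_gt0.
have Gt : G [set n | forall j : 'I_N.+1, `|l j - t n j| < e / N.+1%:R].
  by apply: filter_forall => j; have /cvgrPdist_lt/(_ _ N0) := lP j.
have [n nt] := filter_ex Gt.
have [m [mt /= nm]] := filter_ex (filterI Gt (ooG _ (nbhs_infty_gt n))).
exists n, m; split=> //.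
pose a n w := \sum_(j < N.+1) t n j * f j w.
have ca b : continuous (a b) by exact: continuous_sum_scale.
have aE b w : a b w = \sum_(k < size (c b)) (c b)`_k * f (i k) w.
  rewrite /a /t; under eq_bigr => j _ do rewrite mulr_suml big_mkcond.
  rewrite exchange_big /=; apply: eq_bigr => k _.
  by rewrite -big_mkcond /= (big_pred1 (Ordinal (iN k : (i k < N.+1)%N))).
have ya b : q (fun w => weighted_orbit (c b) x w - a b w) <= e.
  have [c0 c1] := cvx b.
  rewrite (_ : (fun w => _) = fun w => \sum_(k < size (c b)) (c b)`_k * (f k w - f (i k) w)).
    have cff k : continuous (fun w => f k w - f (i k) w).
      by move=> w; apply: cvgB; exact: cf.
    apply: le_trans (@q_sum _ (fun k => (c b)`_k) (fun k w => f k w - f (i k) w) cff) _.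
    rewrite -[leRHS]mul1r -c1 mulr_suml ler_sum// => k _.
    by rewrite (ger0_norm (c0 _)) ler_wpM2l.
  by apply/funext => w; rewrite aE -sumrB; apply: eq_bigr => k _; rewrite mulrBr.
have aa : q (fun w => a n w - a m w) <= (e + e) * D.
  rewrite (_ : (fun w => _) = fun w => \sum_(j < N.+1) (t n j - t m j) * f j w).
    apply: le_trans (@q_sum _ (fun j => t n j - t m j) f cf) _.
    rewrite (_ : (e + e) * D = \sum_(j < N.+1) (e / N.+1%:R + e / N.+1%:R) * D).
      apply: ler_sum => j _; apply: ler_pM => //; first exact: p0 (cabs (cf _)) _.
      rewrite (_ : t n j - t m j = (l j - t m j) - (l j - t n j)); last by ring.
      by rewrite (le_trans (ler_normB _ _))// lerD// ltW.
    have nN : N.+1%:R != 0 :> R by rewrite pnatr_eq0.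
    by rewrite sumr_const card_ord -[RHS]mulr_natr; field.
  by apply/funext => w; rewrite -sumrB; apply: eq_bigr => k _; rewrite mulrBl.
have cya b : continuous (fun w => weighted_orbit (c b) x w - a b w).
  by move=> w; apply: cvgB; [exact: weighted_orbit_continuous|exact: ca].
have cay b : continuous (fun w => a b w - weighted_orbit (c b) x w).
  by move=> w; apply: cvgB; [exact: ca|exact: weighted_orbit_continuous].
have caa : continuous (fun w => a n w - a m w).
  by move=> w; apply: cvgB; exact: ca.
have q1 := q_triangle (cya n) caa.
have ay : q (fun w => a m w - weighted_orbit (c m) x w) <= e.
  rewrite /q (_ : (fun w => _) = fun w => `|weighted_orbit (c m) x w - a m w|); first exact: ya.
  by apply/funext => w; rewrite distrC.
have c2 : continuous (fun w => weighted_orbit (c n) x w - a n w + (a n w - a m w)).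
  by move=> w; apply: cvgD; [exact: cya|exact: caa].
have := q_triangle c2 (cay m).
rewrite {1}/q (_ : (fun w => _) =
    fun w => `|weighted_orbit (c n) x w - weighted_orbit (c m) x w|); last first.
  by apply/funext => w; congr (`|_|); ring.
by have := ya n; move: aa q1 ay eD; lra.
Qed.

End Seminorm.

(** Points [W N sg] realising the finite patterns define an [ultra_average] under which the terms
    stay [(s - r) / 2] apart, against [convex_hull_not_separated]. *)
Lemma convex_not_independent x (c : nat -> seq R) (r s : R) : tame phi -> continuous x ->
  (forall n, convex_w (c n)) -> r < s ->
  ~ independent (fun n => weighted_orbit (c n) x) r s.
Proof.
move=> tm cx cvx rs ind; pose y n := weighted_orbit (c n) x.
have cy n : continuous (y n) by exact: weighted_orbit_continuous.
pose ext N (sg : {ffun 'I_N -> bool}) i := oapp sg false (insub i).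
have Wex N : {W : {ffun 'I_N -> bool} -> Omega & forall (sg : {ffun 'I_N -> bool}) (i : 'I_N),
    if sg i then s <= y i (W sg) else y i (W sg) <= r}.
  apply: (@choice _ _ (fun (sg : {ffun 'I_N -> bool}) w =>
    forall i : 'I_N, if sg i then s <= y i w else y i w <= r)) => sg.
  have [w wP] := ind N (ext N sg); exists w => i.
  by have := wP i (ltn_ord i); rewrite /ext valK.
pose W N := projT1 (Wex N).
have WP N := projT2 (Wex N) : forall (sg : {ffun 'I_N -> bool}) (i : 'I_N),
  if sg i then s <= y i (W N sg) else y i (W N sg) <= r.
have [G [UG ooG]] := ultraFilterLemma eventually_filter.
have bdf := compact_bounded_fun cT.
have pZ (a : R) (f : Omega -> R) : continuous f ->
    ultra_average G W (fun w => a * f w) = a * ultra_average G W f.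
  by move=> /bdf[C fC]; exact: ultra_averageZ fC.
have d0 : 0 < (s - r) / 2 by rewrite divr_gt0// subr_gt0.
have [i [j [ij]]] := convex_hull_not_separated
  (ultra_average_positive_additive R cT UG ooG W) pZ tm cx cvx d0.
have [C yC] : exists C, forall w, `| `|y i w - y j w| | <= C.
  by apply: bdf => w; apply: cvg_norm; apply: cvgB; exact: cy.
rewrite ltNge => /negP; apply; apply: (ultra_average_ge UG ooG yC).
exists j.+1 => // N /= jN.
have ij' : Ordinal (ltn_trans ij jN) != Ordinal jN by rewrite -val_eqE /= ltn_eqF.
exact: (average_separated WP ij').
Qed.

End ConvexHull.

(** * Weak convergence and ergodic sequences *)

Section WeakConvergence.
Variables (R : realType) (Omega : pseudoMetricType R) (phi : Omega -> Omega).
Hypotheses (hT : hausdorff_space Omega) (cT : compact [set: Omega]).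
Hypothesis (cphi : continuous phi).

(* Applied with [Q u := cvg u] and with [Q u := u --> 0]. *)
Lemma dense_span_property (Q : (nat -> R) -> Prop)
    (A : nat -> (Omega -> R) -> Omega -> R) (e : nat -> Omega -> R) (K : R) :
  spans_densely e ->
  (forall n x, continuous x -> continuous (A n x)) ->
  (forall n a x y, A n (fun w => a * x w + y w) = fun w => a * A n x w + A n y w) ->
  (forall n x C, (forall w, `|x w| <= C) -> forall w, `|A n x w| <= K * C) ->
  Q (fun=> 0) -> (forall a u v, Q u -> Q v -> Q (fun n => a * u n + v n)) ->
  (forall u, (forall eps, 0 < eps -> exists2 v, Q v & forall n, `|u n - v n| <= eps) -> Q u) ->
  (forall j m, dual_elt m -> Q (fun n => m (A n (e j)))) ->
  forall x m, continuous x -> dual_elt m -> Q (fun n => m (A n x)).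
Proof.
move=> dense cA linA AK Q0 QD Qcl Qe x m + dm; move: x; apply: dense.
- by move=> j; exact: Qe.
- rewrite (_ : (fun n => _) = fun=> 0)//; apply/funext => n.
  have c0 : continuous (fun _ : Omega => 0 : R) by move=> w; exact: cvg_cst.
  have A0 : A n (fun=> 0) = fun=> 0.
    have := linA n (-1) (fun=> 0) (fun=> 0).
    rewrite (_ : (fun w => _) = fun=> 0); last by apply/funext => w; rewrite mulr0 addr0.
    by move=> ->; apply/funext => w; rewrite mulN1r addNr.
  by rewrite A0 (dual0 dm).
- move=> a x y cx cy Px Py.
  rewrite (_ : (fun n => _) = fun n => a * m (A n x) + m (A n y)); first exact: QD.
  by apply/funext => n; rewrite linA (dual_linear dm) //; exact: cA.
- move=> x cx xP; apply: Qcl => eps eps0.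
  have [M M0 MP] := dual_bound cT dm.
  have MK : 0 < M * `|K| + 1 by rewrite ltr_wpDl// mulr_ge0.
  have d0 : 0 < eps / (M * `|K| + 1) by rewrite divr_gt0.
  have [y [cy Py xy]] := xP _ d0; exists (fun n => m (A n y)) => // n.
  rewrite -(dualB dm (cA n _ cx) (cA n _ cy)).
  have -> : (fun w => A n x w - A n y w) = A n (fun w => x w - y w).
    have := linA n (-1) y x.
    rewrite (_ : (fun w => _) = fun w => x w - y w).
      by move=> ->; apply/funext => w; rewrite mulN1r addrC.
    by apply/funext => w; rewrite mulN1r addrC.
  have cxy : continuous (fun w => x w - y w).
    by move=> w; apply: cvgB; [exact: cx|exact: cy].
  apply: le_trans (MP _ (`|K| * (eps / (M * `|K| + 1))) (cA _ _ cxy) _ _) _.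
  + by rewrite mulr_ge0// ltW.
  + move=> w; apply: le_trans (AK _ _ _ xy w) _.
    by rewrite ler_wpM2r ?(ltW d0)// ler_norm.
  + rewrite !mulrA ler_pdivrMr// mulrC mulrDr mulr1 lerDl; exact: ltW.
Qed.

Lemma cvg_uniform_approx (u : nat -> R) :
  (forall eps, 0 < eps -> exists2 v : nat -> R, cvg (v @ \oo) & forall n, `|u n - v n| <= eps) ->
  cvg (u @ \oo).
Proof.
move=> uP; apply: cauchy_cvg; apply: cauchy_exP => eps eps0.
have e4 : 0 < eps / 4 by rewrite divr_gt0.
have [v /cvg_ex[l /cvgrPdist_lt/(_ _ e4) vl] uv] := uP _ e4.
exists l; apply: filterS vl => n vl; rewrite /ball /=.
rewrite (_ : l - u n = (l - v n) - (u n - v n)); last by ring.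
by have := uv n; have := ler_normB (l - v n) (u n - v n); move: vl e4; lra.
Qed.

Lemma cvg0_uniform_approx (u : nat -> R) :
  (forall eps, 0 < eps -> exists2 v : nat -> R, v @ \oo --> (0 : R) &
    forall n, `|u n - v n| <= eps) -> u @ \oo --> (0 : R).
Proof.
move=> uP; apply/cvgrPdist_lt => eps eps0.
have e4 : 0 < eps / 4 by rewrite divr_gt0.
have [v /cvgrPdist_lt/(_ _ e4) vl uv] := uP _ e4.
apply: filterS vl => n vl.
rewrite (_ : 0 - u n = (0 - v n) - (u n - v n)); last by ring.
by have := uv n; have := ler_normB (0 - v n) (u n - v n); move: vl e4; lra.
Qed.

Lemma lim_norm_le (u : nat -> R) (l B : R) : u @ \oo --> l -> (forall n, `|u n| <= B) -> `|l| <= B.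
Proof.
move=> ul uB; rewrite leNgt; apply/negP => Bl.
have e0 : 0 < `|l| - B by rewrite subr_gt0.
have /cvgrPdist_lt/(_ _ e0)[N _ /(_ N (leqnn N)) /=] := ul.
by have := lerB_dist l (u N); have := uB N; lra.
Qed.

(** The limit operator is the pointwise limit. Convex combinations of the orbit do not increase the
    sup norm, so its norm constant is 1. *)
Lemma wo_cvg_seq_of_cvg (c : nat -> seq R) : (forall n, convex_w (c n)) ->
  (forall x m, continuous x -> dual_elt m ->
    cvg (m (weighted_orbit phi (c n) x) @[n --> \oo])) ->
  wo_cvg_seq (fun n => Vc phi (c n)).
Proof.
move=> cvx ccvg.
pose T (m : (Omega -> R) -> R) x := lim (m (weighted_orbit phi (c n) x) @[n --> \oo]).
have TP x m : continuous x -> dual_elt m ->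
  m (weighted_orbit phi (c n) x) @[n --> \oo] --> T m x by move=> cx dm; exact: ccvg.
have cwo n x : continuous x -> continuous (weighted_orbit phi (c n) x).
  exact: weighted_orbit_continuous.
have wole n x (C : R) : (forall w, `|x w| <= C) -> forall w, `|weighted_orbit phi (c n) x w| <= C.
  by move=> xC; exact: weighted_orbit_bound.
exists T; split; last by move=> x m cx dm; exact: TP.
split; [|split].
- move=> m dm; split.
    move=> a x y cx cy; apply: (cvg_lim (@Rhausdorff R)).
    rewrite (_ : (fun n => _) = fun n =>
        a * m (weighted_orbit phi (c n) x) + m (weighted_orbit phi (c n) y)).
      by apply: cvgD; [apply: cvgMr|]; exact: TP.
    by apply/funext => n; rewrite weighted_orbit_linear (dual_linear dm)//; exact: cwo.
  have [M M0 MP] := dual_bound cT dm; exists M => x cx.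
  apply: lim_norm_le (TP _ _ cx dm) _ => n; apply: MP; first exact: cwo.
    exact: supnorm_ge0.
  by apply: wole => w; exact: supnorm_ub.
- move=> a m n dm dn x cx; apply: (cvg_lim (@Rhausdorff R)).
  by apply: cvgD; [apply: cvgMr|]; exact: TP.
- exists 1 => m dm; rewrite mul1r; apply: ge_sup.
    exists `|T m (fun=> 0)|, (fun=> 0) => //; split; first by move=> w; exact: cvg_cst.
    by apply: supnorm_le => // w; rewrite normr0.
  move=> _ [x [cx x1] <-]; apply: lim_norm_le (TP _ _ cx dm) _ => n.
  apply: sup_upper_bound.
    split; first by exists `|m x|, x.
    have [M M0 MP] := dual_bound cT dm; exists (M * 1) => _ [y [cy y1] <-].
    by apply: MP => // w; rewrite (le_trans (supnorm_ub cT w cy)).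
  exists (weighted_orbit phi (c n) x) => //; split; first exact: cwo.
  apply: supnorm_le => //; apply: wole => w.
  by rewrite (le_trans (supnorm_ub cT w cx)).
Qed.

Lemma IdmV_pairE s m x : dual_elt m -> continuous x ->
  IdmV_pair phi (Vc phi s) m x = m (weighted_orbit phi s (fun w => x w - x (phi w))).
Proof.
move=> dm cx; have cxp : continuous (fun w => x (phi w)) by exact: (@iter_continuous _ _ _ cphi x 1).
by rewrite weighted_orbitB (dualB dm)//; apply: weighted_orbit_continuous.
Qed.

(** Lets convergence against functionals be read pointwise. *)
Lemma eval_dual_elt w : dual_elt (fun x : Omega -> R => x w).
Proof. by split=> //; exists 1 => x cx; rewrite mul1r supnorm_ub. Qed.

Lemma ergodic_netE (c : nat -> seq R) :
  ergodic_net phi nat_le c <-> forall x m, continuous x -> dual_elt m ->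
    m (weighted_orbit phi (c n) (fun w => x w - x (phi w))) @[n --> \oo] --> (0 : R).
Proof.
split=> H x m cx dm; last first.
  have /cvgrPdist_lt H' := H x m cx dm.
  move=> e e0; have [N _ NP] := H' e e0; exists N => n Nn.
  by have := NP n Nn; rewrite /= sub0r normrN subr0 IdmV_pairE.
apply/cvgrPdist_lt => e e0; have [N NP] := H x m cx dm e e0; exists N => // n Nn.
by have := NP n Nn; rewrite /= sub0r normrN subr0 IdmV_pairE.
Qed.

(** [rosenthal_sequence] treats all functions [e j] at once along increasing indices. Bounded
    convergence makes the convergence weak, and the dense span extends it to all [x]. *)
Lemma convergent_subsequence (c : nat -> seq R) : tame phi -> (forall n, convex_w (c n)) ->
  exists sub : nat -> nat, {homo sub : i j / (i < j)%N} /\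
    wo_cvg_seq (fun n => Vc phi (c (sub n))).
Proof.
move=> tm cvx; have [e ce dense] := countable_dense_span hT cT.
have [G [UG ooG]] := ultraFilterLemma eventually_filter.
have /choice[C eC] : forall j, exists C, forall w, `|e j w| <= C.
  by move=> j; exact: compact_bounded_fun.
have [h|j a w|j r s h rs _|h [/hist_increasing hinc hcvg]] := @rosenthal_sequence R nat Omega G
  (fun j n => weighted_orbit phi (c n) (e j)) (fun h => [set a | all (ltn^~ a) h]) C UG.
- by apply: ooG; exact: near_lt_all.
- exact: weighted_orbit_bound.
- exact: (convex_not_independent cT cphi tm (ce j) (fun n => cvx (h n)) rs).
exists h; split=> //; apply: wo_cvg_seq_of_cvg => //.
apply: (@dense_span_property (fun u => cvg (u @ \oo)) (fun n => weighted_orbit phi (c (h n))) e 1).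
- exact: dense.
- by move=> n x; exact: weighted_orbit_continuous.
- by move=> n a x y; exact: weighted_orbit_linear.
- by move=> n x D xD w; rewrite mul1r; exact: weighted_orbit_bound.
- exact: is_cvg_cst.
- by move=> a u v cu cv; apply: is_cvgD => //; exact: is_cvgMr.
- exact: cvg_uniform_approx.
- move=> j m dm; apply: (dual_cvg cT dm (C := C j)) => [n|n w|w].
  + exact: weighted_orbit_continuous.
  + exact: weighted_orbit_bound.
  + exact: hcvg.
Qed.

(** Tested on point evaluations, ergodicity makes the averages of each [d (e j)] tend to 0 pointwise
    along an ultrafilter containing the tails of the net. [compact_null_sequence] extracts a
    sequence, and bounded convergence passes from points to all functionals. *)
Lemma ergodic_sequence_of_net (I : Type) (le : I -> I -> Prop) (c : I -> seq R) : tame phi ->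
  directed le -> (forall a, convex_w (c a)) -> ergodic_net phi le c ->
  exists al : nat -> I, ergodic_net phi nat_le (c \o al).
Proof.
move=> tm [[i0 _] [lexx [letr ledir]]] cvx erg.
have [e ce dense] := countable_dense_span hT cT.
pose F := [set A : set I | exists a0, forall a, le a0 a -> A a].
have PF : ProperFilter F.
  split; first by move=> [a0 /(_ a0 (lexx a0))].
  split; first by exists i0.
  - move=> A B [a aA] [b bB]; have [d [ad bd]] := ledir a b; exists d => i di.
    by split; [apply: aA; exact: letr di|apply: bB; exact: letr di].
  - by move=> A B AB [a aA]; exists a => i /aA /AB.
have [G [UG FG]] := ultraFilterLemma PF.
pose d x w : R := x w - x (phi w).
have cd x : continuous x -> continuous (d x).
  by move=> cx w; apply: cvgB; [exact: cx|exact: (@iter_continuous _ _ _ cphi x 1)].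
have [j a|j w|j r s f rs|al alP] := @compact_null_sequence R I Omega G
    (fun j a => weighted_orbit phi (c a) (d (e j))) UG cT.
- by apply: weighted_orbit_continuous; [|exact: cd].
- apply/cvgrPdist_lt => t t0; apply: FG.
  have [a0 a0P] := erg (e j) _ (ce j) (eval_dual_elt w) t t0; exists a0 => a /a0P.
  by rewrite (IdmV_pairE _ (eval_dual_elt w) (ce j)) subr0 sub0r normrN.
- exact: (convex_not_independent cT cphi tm (cd _ (ce j)) (fun n => cvx (f n)) rs).
exists al; apply/ergodic_netE.
(* The constant 2 comes from [d x], a difference of two functions with the bound of [x]. *)
apply: (@dense_span_property (fun u => u @ \oo --> (0 : R))
  (fun n x => weighted_orbit phi (c (al n)) (d x)) e 2).
- exact: dense.
- by move=> n x cx; apply: weighted_orbit_continuous; [|exact: cd].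
- move=> n a x y; rewrite -weighted_orbit_linear; congr (weighted_orbit _ _ _).
  by apply/funext => w; rewrite /d; ring.
- move=> n x D xD w; apply: weighted_orbit_bound => // v.
  by rewrite (le_trans (ler_normB _ _))// mulr_natl mulr2n lerD.
- exact: cvg_cst.
- move=> a u v cu cv; rewrite -(addr0 (0 : R)); apply: cvgD => //.
  by rewrite -(mulr0 a); exact: cvgMr.
- exact: cvg0_uniform_approx.
- move=> j m dm; have [C eC] := compact_bounded_fun cT (cd _ (ce j)).
  apply: (dual_cvg0 cT dm (C := C)) => [n|n w|w].
  + by apply: weighted_orbit_continuous; [|exact: cd].
  + exact: weighted_orbit_bound.
  + exact: alP.
Qed.

Lemma cesaro_convex n : convex_w (cesaro_w R n).
Proof.
split=> [k|].
  by rewrite nth_nseq; case: ifP => // _; rewrite invr_ge0.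
rewrite size_nseq (eq_bigr (fun=> n.+1%:R^-1)); last first.
  by move=> k _; rewrite nth_nseq ltn_ord.
by rewrite sumr_const card_ord -[LHS]mulr_natr mulVf// pnatr_eq0.
Qed.

(** The average of [x - x \o phi] telescopes to the difference of [x] and its iterate of order
    [n + 1], divided by [n + 1]. *)
Lemma cesaro_ergodic : ergodic_net phi nat_le (cesaro_w R).
Proof.
apply/ergodic_netE => x m cx dm.
have [C xC] := compact_bounded_fun cT cx; have [M M0 MP] := dual_bound cT dm.
have cxp : continuous (fun w => x w - x (phi w)).
  by move=> w; apply: cvgB; [exact: cx|exact: (@iter_continuous _ _ _ cphi x 1)].
have woE n w : weighted_orbit phi (cesaro_w R n) (fun w => x w - x (phi w)) w =
    n.+1%:R^-1 * (x w - x (iter n.+1 phi w)).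
  rewrite /weighted_orbit size_nseq
    (eq_bigr (fun k : 'I_n.+1 => n.+1%:R^-1 * (x (iter k phi w) - x (iter k.+1 phi w)))).
    rewrite -mulr_sumr; congr (_ * _); rewrite -[RHS]opprB.
    have <- : \sum_(0 <= k < n.+1) (x (iter k.+1 phi w) - x (iter k phi w)) =
        x (iter n.+1 phi w) - x w := telescope_sumr (fun k => x (iter k phi w)) (leq0n _).
    by rewrite big_mkord -sumrN; apply: eq_bigr => k _; rewrite opprB.
  by move=> k _; rewrite nth_nseq ltn_ord.
apply/cvgrPdist_lt => e e0.
pose D := M * (`|C| + `|C|).
have D0 : 0 <= D by rewrite mulr_ge0// addr_ge0.
have [N NP] : exists N, D / e < N%:R :> R.
  by exists (Num.bound (D / e)); apply: archi_boundP; rewrite divr_ge0// ltW.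
exists N => // n /= Nn; rewrite sub0r normrN.
have n0 : 0 < n.+1%:R :> R by [].
apply: (@le_lt_trans _ _ (M * (n.+1%:R^-1 * (`|C| + `|C|)))).
  apply: MP; first exact: weighted_orbit_continuous.
    by rewrite mulr_ge0 ?invr_ge0// addr_ge0.
  move=> w; rewrite woE normrM ger0_norm ?invr_ge0// ler_wpM2l ?invr_ge0//.
  rewrite (le_trans (ler_normB _ _))// lerD// (le_trans (xC _))// ler_norm//.
rewrite mulrCA -/D mulrC ltr_pdivrMr// mulrC -ltr_pdivrMr//.
by rewrite (lt_le_trans NP)// ler_nat ltnW.
Qed.

End WeakConvergence.

(** * Ergodic nets, ergodic sequences and Cesaro means *)

Theorem theorem3p3 (R : realType) (Omega : pseudoMetricType R)
  (phi : Omega -> Omega) :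
  hausdorff_space Omega -> compact [set: Omega] -> continuous phi ->
  tame phi ->
  (* (i) ergodic nets *)
  (forall (I : Type) (le : I -> I -> Prop) (c : I -> seq R),
     directed le -> (forall a, convex_w (c a)) -> ergodic_net phi le c ->
     exists al : nat -> I,
       ergodic_net phi nat_le (fun n => c (al n)) /\
       wo_cvg_seq (fun n => Vc phi (c (al n)))) /\
  (* (ii) ergodic sequences *)
  (forall c : nat -> seq R,
     (forall n, convex_w (c n)) -> ergodic_net phi nat_le c ->
     exists sub : nat -> nat, (forall i j, (i < j)%N -> (sub i < sub j)%N) /\
       ergodic_net phi nat_le (fun n => c (sub n)) /\
       wo_cvg_seq (fun n => Vc phi (c (sub n)))) /\
  (* Cesaro means *)
  (exists sub : nat -> nat, (forall i j, (i < j)%N -> (sub i < sub j)%N) /\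
     wo_cvg_seq (fun n => Vc phi (cesaro_w R (sub n)))).
Proof.
move=> hT cT cphi tm.
have ii (c : nat -> seq R) : (forall n, convex_w (c n)) -> ergodic_net phi nat_le c ->
    exists sub : nat -> nat, (forall i j, (i < j)%N -> (sub i < sub j)%N) /\
      ergodic_net phi nat_le (fun n => c (sub n)) /\
      wo_cvg_seq (fun n => Vc phi (c (sub n))).
  move=> cvx erg; have [sub [sinc scvg]] := convergent_subsequence hT cT cphi tm cvx.
  exists sub; split=> //; split=> // x m cx dm e e0.
  (* As [i <= sub i], the subsequence inherits ergodicity. *)
  have sge i : (i <= sub i)%N by elim: i => // i /leq_ltn_trans; apply; exact: sinc.
  have [N NP] := erg x m cx dm e e0; exists N => n Nn; apply: NP.
  exact: leq_trans Nn (sge n).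
split; [|split=> //].
(* The net is first reduced to an ergodic sequence, to which [ii] applies. *)
- move=> I le c dir cvx erg.
  have [al erg'] := ergodic_sequence_of_net hT cT cphi tm dir cvx erg.
  have [sub [_ [serg scvg]]] := ii _ (fun n => cvx (al n)) erg'.
  by exists (al \o sub).
- have [sub [sinc [_ scvg]]] := ii _ (@cesaro_convex R) (cesaro_ergodic cT cphi).
  by exists sub.
Qed.
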